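(* Let $X$ be a proper CAT(0) space with base point $\mathfrak o$, let $\kappa$ be as in the standing assumptions, and let $\mathbf b$ be an equivalence class of quasi-geodesic rays in $X$ under $\kappa$--fellow travelling. The following are equivalent: (1) $\mathbf b$ contains a geodesic ray $b$ that is $\kappa$--contracting; (2) every quasi-geodesic ray $\beta\in\mathbf b$ is $\kappa$--contracting; (3) every quasi-geodesic ray $\beta\in\mathbf b$ is $\kappa$--Morse; (4) there exists a quasi-geodesic ray $\beta\in\mathbf b$ that is $\kappa$--Morse; (5) $\mathbf b$ contains a geodesic ray $b$ that is $\kappa$--Morse for $(32,0)$--quasi-geodesics, i.e. there is a constant $M$ such that every $(32,0)$--quasi-geodesic segment with both end points on $b$ is contained in $\mathcal N_\kappa(b,M)$.
   Context: $X$ is a proper CAT(0) geodesic metric space with a fixed base point $\mathfrak o$; write $\|x\|=d_X(\mathfrak o,x)$. Fix $\kappa:[0,\infty)\to[1,\infty)$ monotone increasing, concave and sublinear ($\kappa(t)/t\to0$), and write $\kappa(x):=\kappa(\|x\|)$ for $x\in X$. A $(q,Q)$--quasi-geodesic is a continuous map $\beta$ from an interval to $X$ with $\frac1q|s-t|-Q\le d_X(\beta(s),\beta(t))\le q|s-t|+Q$; a (quasi-)geodesic ray is defined on $[0,\infty)$ and always satisfies $\beta(0)=\mathfrak o$. Quasi-geodesics are identified with their images when convenient. For a closed set $Z$, $x_Z$ denotes the set of nearest points of $Z$ to $x$ and $d_X(x,Z)$ the distance. The $(\kappa,n)$--neighbourhood is $\mathcal N_\kappa(Z,n)=\{x\in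 X: d_X(x,Z)\le n\,\kappa(x)\}$. Two quasi-geodesic rays $\beta,\gamma$ $\kappa$--fellow travel if each lies in some $(\kappa,n)$--neighbourhood of the other; this is an equivalence relation, with class $[\beta]$. A closed set $Z$ is $\kappa$--Morse if there is a function $m_Z:\mathbb R_+^2\to\mathbb R_+$ such that every $(q,Q)$--quasi-geodesic segment with end points on $Z$ lies in $\mathcal N_\kappa(Z,m_Z(q,Q))$. A closed set $Z$ is $\kappa$--contracting if there is a constant $c_Z$ such that for all $x,y\in X$ with $d_X(x,y)\le d_X(x,Z)$ we have $\operatorname{diam}(x_Z\cup y_Z)\le c_Z\,\kappa(x)$. A quasi-geodesic is called $\kappa$--Morse / $\kappa$--contracting if its image is. *)

(* Defs.v *)
From Stdlib Require Import Reals Lra.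
Open Scope R_scope.
Set Implicit Arguments.

Section Defs.
Variable X : Type.
Variable d : X -> X -> R.

Definition is_metric : Prop :=
  (forall x y, 0 <= d x y) /\ (forall x y, d x y = 0 <-> x = y) /\
  (forall x y, d x y = d y x) /\ (forall x y z, d x z <= d x y + d y z).

(* sequential compactness of a subset (equivalent to compactness in metric spaces) *)
Definition seq_compact (K : X -> Prop) : Prop :=
  forall u : nat -> X, (forall n, K (u n)) ->
  exists (phi : nat -> nat) (x : X),
    (forall n m, (n < m)%nat -> (phi n < phi m)%nat) /\ K x /\
    forall eps, 0 < eps -> exists N, forall n, (N <= n)%nat -> d (u (phi n)) x < eps.

Definition proper_space : Prop :=
  forall x r, seq_compact (fun y => d x y <= r).

Definition geodesic_segment (s : R -> X) (L : R) : Prop :=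
  0 <= L /\ forall u v, 0 <= u <= L -> 0 <= v <= L -> d (s u) (s v) = Rabs (u - v).

Definition geodesic_space : Prop :=
  forall x y, exists s, geodesic_segment s (d x y) /\ s 0 = x /\ s (d x y) = y.

(* CAT(0) comparison inequality: for two points on two sides of a geodesic
   triangle p q r emanating from the common vertex p, the distance is at most
   the distance of the comparison points in the Euclidean comparison triangle
   (written via the law of cosines). *)
Definition CAT0_comparison : Prop :=
  forall p q r (s1 s2 : R -> X),
    geodesic_segment s1 (d p q) -> s1 0 = p -> s1 (d p q) = q ->
    geodesic_segment s2 (d p r) -> s2 0 = p -> s2 (d p r) = r ->
    0 < d p q -> 0 < d p r ->
    forall u v, 0 <= u <= d p q -> 0 <= v <= d p r ->
      (d (s1 u) (s2 v)) ^ 2 <=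
      u ^ 2 + v ^ 2 - u * v * (d p q ^ 2 + d p r ^ 2 - d q r ^ 2) / (d p q * d p r).

Definition CAT0_space : Prop := is_metric /\ geodesic_space /\ CAT0_comparison.

Definition kappa_ok (kappa : R -> R) : Prop :=
  (forall s t, 0 <= s <= t -> kappa s <= kappa t) /\
  (forall s t l, 0 <= s -> 0 <= t -> 0 <= l <= 1 ->
      l * kappa s + (1 - l) * kappa t <= kappa (l * s + (1 - l) * t)) /\
  (forall t, 0 <= t -> 1 <= kappa t) /\
  (forall eps, 0 < eps -> exists T, 0 < T /\ forall t, T <= t -> kappa t <= eps * t).

Definition is_inf (E : R -> Prop) (r : R) : Prop :=
  (forall y, E y -> r <= y) /\ (forall r', (forall y, E y -> r' <= y) -> r' <= r).

Definition dist_set (Z : X -> Prop) (x : X) (r : R) : Prop :=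
  is_inf (fun v => exists z, Z z /\ v = d x z) r.

Definition proj_pt (Z : X -> Prop) (x z : X) : Prop := Z z /\ dist_set Z x (d x z).

Variable o : X.
Variable kappa : R -> R.

Definition Nbhd (Z : X -> Prop) (n : R) (x : X) : Prop :=
  exists r, dist_set Z x r /\ r <= n * kappa (d o x).

Definition cont_on (b : R -> X) (I : R -> Prop) : Prop :=
  forall t, I t -> forall eps, 0 < eps -> exists del, 0 < del /\
    forall s, I s -> Rabs (s - t) < del -> d (b s) (b t) < eps.

Definition qg_ineq (b : R -> X) (q Q : R) (I : R -> Prop) : Prop :=
  forall s t, I s -> I t ->
    (1 / q) * Rabs (s - t) - Q <= d (b s) (b t) <= q * Rabs (s - t) + Q.

Definition qg_segment (g : R -> X) (q Q a b : R) : Prop :=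
  a <= b /\ cont_on g (fun t => a <= t <= b) /\ qg_ineq g q Q (fun t => a <= t <= b).

Definition ray_dom (t : R) : Prop := 0 <= t.

Definition qg_ray (g : R -> X) : Prop :=
  exists q Q, 1 <= q /\ 0 <= Q /\
    g 0 = o /\ cont_on g ray_dom /\ qg_ineq g q Q ray_dom.

Definition geodesic_ray (g : R -> X) : Prop :=
  g 0 = o /\ forall s t, 0 <= s -> 0 <= t -> d (g s) (g t) = Rabs (s - t).

Definition image (g : R -> X) (x : X) : Prop := exists t, 0 <= t /\ g t = x.

Definition fellow_travel (g h : R -> X) : Prop :=
  (exists n, forall x, image g x -> Nbhd (image h) n x) /\
  (exists n, forall x, image h x -> Nbhd (image g) n x).

Definition kappa_Morse (Z : X -> Prop) : Prop :=
  exists m : R -> R -> R, (forall q Q, 0 <= m q Q) /\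
    forall q Q, 0 < q -> 0 <= Q ->
    forall (g : R -> X) a b, qg_segment g q Q a b -> Z (g a) -> Z (g b) ->
      forall t, a <= t <= b -> Nbhd Z (m q Q) (g t).

Definition kappa_contracting (Z : X -> Prop) : Prop :=
  exists c, forall x y, (exists r, dist_set Z x r /\ d x y <= r) ->
    forall p1 p2, (proj_pt Z x p1 \/ proj_pt Z y p1) ->
                  (proj_pt Z x p2 \/ proj_pt Z y p2) ->
                  d p1 p2 <= c * kappa (d o x).

Definition Morse_32 (Z : X -> Prop) : Prop :=
  exists M, forall (g : R -> X) a b, qg_segment g 32 0 a b -> Z (g a) -> Z (g b) ->
      forall t, a <= t <= b -> Nbhd Z M (g t).

End Defs.

(* Main.v *)
(** The cycle is (1) => (2) => (3) => (4) => (1), with (5) attached to (1).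

    (1) => (2).  As the base point lies on every ray, all points involved have
    norm at most a multiple of [||x||], so that all errors are multiples of
    [kappa x]; contraction, in the form "[d(x,y) <= d(x,Z) + e] bounds the
    distance of the projections by [O(kappa x + e)]", then passes from one set
    to another one which fellow travels it.

    (2) => (3).  On an excursion of length [l] of a quasi-geodesic far from [Z]
    the projection moves much slower than the quasi-geodesic, so [l] is bounded
    by the values of [kappa] along the excursion; these are at most
    [kappa x + eta l + C], for arbitrarily small [eta], because [kappa] is
    subadditive and sublinear.

    (4) => (1).  Geodesics from the base point to far points of a Morse ray stay
    at distance [O(kappa r)] from each other at time [r]; by comparison their
    distance at time [t] is at most [t O(kappa r) / r], so they converge to a
    geodesic ray.  For a geodesic ray near a set which is Morse for
    (3,0)-quasi-geodesics, right-angled triangles with a long leg on the ray are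
    almost degenerate, and comparing angles gives contraction.  The latter
    argument applies in particular to (5), with the ray itself as the set. *)
Require Import Defs.
From Stdlib Require Import Reals Lra Lia Psatz Classical IndefiniteDescription.
Open Scope R_scope.

(** * Intervals of the real line *)

(** [P] need not be closed, so the supremum of the times where it holds may be no such time. [s0]
    and [s1] lie within 1/2 of it on either side; later constants absorb the gap. *)
Lemma last_before (P : R -> Prop) (a r : R) :
  a <= r -> P a -> ~ P r ->
  exists s0 s1, a <= s0 /\ s0 <= s1 /\ s1 <= r /\ s1 - s0 <= 1 /\ P s0 /\
    forall t, s1 <= t <= r -> ~ P t.
Proof.
  intros Har Pa Pr.
  destruct (completeness (fun s => a <= s <= r /\ P s)) as [S [HS1 HS2]].
  - exists r. intros s [[_ H] _]. exact H.
  - exists a. split; [lra | exact Pa].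
  - assert (HaS : a <= S) by (apply HS1; split; [lra | exact Pa]).
    assert (HSr : S <= r) by (apply HS2; intros s [[_ H] _]; exact H).
    assert (H0 : exists s0, (a <= s0 <= r /\ P s0) /\ S - /2 < s0).
    { apply NNPP. intro Hn.
      assert (S <= S - /2); [| lra].
      apply HS2. intros s Hs.
      destruct (Rle_or_lt s (S - /2)) as [|Hlt]; [assumption |].
      exfalso. apply Hn. exists s. split; [exact Hs | exact Hlt]. }
    destruct H0 as [s0 [Hs0 Hlt]].
    assert (Hs0S : s0 <= S) by (apply HS1; exact Hs0).
    exists s0, (Rmin r (S + /2)).
    assert (Hm := Rmin_l r (S + /2)). assert (Hm' := Rmin_r r (S + /2)).
    assert (s0 <= Rmin r (S + /2)) by (apply Rmin_glb; lra).
    repeat split; try lra; try tauto.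
    intros t [Ht1 Ht2] Pt.
    assert (HtS : t <= S) by (apply HS1; split; [lra | exact Pt]).
    unfold Rmin in Ht1. destruct (Rle_dec r (S + /2)); [| lra].
    assert (t = r) by lra. subst. contradiction.
Qed.

Lemma first_after (P : R -> Prop) (r b : R) :
  r <= b -> P b -> ~ P r ->
  exists t1 t0, r <= t1 /\ t1 <= t0 /\ t0 <= b /\ t0 - t1 <= 1 /\ P t0 /\
    forall t, r <= t <= t1 -> ~ P t.
Proof.
  intros Hrb Pb Pr.
  destruct (last_before (fun t => P (- t)) (- b) (- r))
    as (s0 & s1 & H1 & H2 & H3 & H4 & H5 & H6).
  - lra.
  - rewrite Ropp_involutive. exact Pb.
  - rewrite Ropp_involutive. exact Pr.
  - exists (- s1), (- s0). repeat split; try lra; try assumption.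
    intros t Ht Pt. apply (H6 (- t)); [lra |]. rewrite Ropp_involutive. exact Pt.
Qed.

Lemma continuous_attains_min (f : R -> R) (a b : R) :
  a <= b ->
  (forall t, a <= t <= b -> forall eps, 0 < eps -> exists del, 0 < del /\
     forall s, a <= s <= b -> Rabs (s - t) < del -> Rabs (f s - f t) < eps) ->
  exists t, a <= t <= b /\ forall s, a <= s <= b -> f t <= f s.
Proof.
  intros Hab Hf.
  (* Composing with this 1-Lipschitz retraction turns continuity relative to [[a, b]] into the
     continuity that [continuity_ab_min] asks for. *)
  set (clamp := fun t => Rmax a (Rmin b t)).
  assert (Hc : forall t, a <= clamp t <= b).
  { intro t. unfold clamp, Rmax, Rmin.
    destruct (Rle_dec b t); destruct (Rle_dec a _); lra. }
  assert (Hl : forall s t, Rabs (clamp s - clamp t) <= Rabs (s - t)).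
  { intros s t. unfold clamp, Rmax, Rmin, Rabs.
    destruct (Rle_dec b s), (Rle_dec b t); repeat destruct (Rle_dec a _);
      repeat destruct (Rcase_abs _); lra. }
  assert (Hi : forall t, a <= t <= b -> clamp t = t).
  { intros t Ht. unfold clamp, Rmax, Rmin.
    destruct (Rle_dec b t); destruct (Rle_dec a _); lra. }
  destruct (continuity_ab_min (fun t => f (clamp t)) a b Hab) as [m [Hm Hm']].
  - intros t Ht eps Heps. destruct (Hf (clamp t) (Hc t) eps Heps) as [del [Hd H]].
    exists del. split; [exact Hd |]. intros s [_ Hs]. simpl. unfold Rdist in *.
    apply H; [apply Hc |]. eapply Rle_lt_trans; [apply Hl | exact Hs].
  - exists m. split; [exact Hm' |]. intros s Hs.
    specialize (Hm s Hs). simpl in Hm. rewrite !Hi in Hm; assumption.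
Qed.

(** * Growth of [kappa] *)

Section Kappa.

Variable kappa : R -> R.
Hypothesis Hk : kappa_ok kappa.

Lemma kappa_mono s t : 0 <= s -> s <= t -> kappa s <= kappa t.
Proof. intros. apply Hk; lra. Qed.

Lemma kappa_ge1 t : 0 <= t -> 1 <= kappa t.
Proof. apply Hk. Qed.

Lemma kappa_scale a t : 1 <= a -> 0 <= t -> kappa (a * t) <= a * kappa t.
Proof.
  intros Ha Ht. destruct Hk as (_ & Hconc & H1 & _).
  assert (Hi : 0 < / a) by (apply Rinv_0_lt_compat; lra).
  assert (Hi1 : / a <= 1) by (rewrite <- Rinv_1; apply Rinv_le_contravar; lra).
  assert (Hat : 0 <= a * t) by nra.
  assert (H := Hconc (a * t) 0 (/ a) Hat (Rle_refl 0) ltac:(lra)).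
  replace (/ a * (a * t) + (1 - / a) * 0) with t in H by (field; lra).
  assert (H0 := H1 0 (Rle_refl 0)).
  assert (H2 : / a * kappa (a * t) <= kappa t) by nra.
  replace (kappa (a * t)) with (a * (/ a * kappa (a * t))) by (field; lra).
  apply Rmult_le_compat_l; lra.
Qed.

(** Both [s] and [t] are convex combinations of [s + t] and 0, with swapped weights; add the two
    concavity inequalities. *)
Lemma kappa_subadd s t : 0 <= s -> 0 <= t -> kappa (s + t) <= kappa s + kappa t.
Proof.
  intros Hs Ht. destruct Hk as (_ & Hconc & H1 & _).
  assert (Hs1 := H1 s Hs). assert (Ht1 := H1 t Ht).
  destruct (Req_dec (s + t) 0) as [E|E].
  { replace (s + t) with s by lra. lra. }
  assert (Hst : 0 < s + t) by lra.
  set (l := s / (s + t)).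
  assert (Hl : 0 <= l <= 1).
  { unfold l. split.
    - apply Rmult_le_pos; [lra |]. left. apply Rinv_0_lt_compat. lra.
    - apply Rmult_le_reg_r with (s + t); [lra |]. unfold Rdiv.
      rewrite Rmult_assoc, Rinv_l by lra. lra. }
  assert (A := Hconc (s + t) 0 l ltac:(lra) (Rle_refl 0) Hl).
  assert (B := Hconc 0 (s + t) l (Rle_refl 0) ltac:(lra) Hl).
  replace (l * (s + t) + (1 - l) * 0) with s in A by (unfold l; field; lra).
  replace (l * 0 + (1 - l) * (s + t)) with t in B by (unfold l; field; lra).
  assert (H0 := H1 0 (Rle_refl 0)). nra.
Qed.

Lemma kappa_affine_bound eta :
  0 < eta -> exists C, 0 <= C /\ forall t, 0 <= t -> kappa t <= eta * t + C.
Proof.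
  intro He. destruct Hk as (Hm & _ & H1 & Hs).
  destruct (Hs eta He) as [T [HT H]].
  exists (kappa T). split.
  - assert (A := H1 T ltac:(lra)). lra.
  - intros t Ht. destruct (Rle_or_lt T t) as [Hle|Hlt].
    + assert (A := H t Hle). assert (B := H1 T ltac:(lra)). lra.
    + assert (A := Hm t T ltac:(lra)). nra.
Qed.

(** Makes [kappa] comparable at points whose distance is a multiple of [kappa]: subadditivity leaves
    [kappa (C * kappa t)], and [kappa] grows at most linearly. *)
Lemma kappa_perturb C :
  0 <= C -> exists C', 1 <= C' /\
    forall t r, 0 <= t -> 0 <= r -> r <= t + C * kappa t -> kappa r <= C' * kappa t.
Proof.
  intro HC. destruct (kappa_affine_bound 1 Rlt_0_1) as [C1 [HC1 H]].
  exists (1 + C + C1). split; [lra |]. intros t r Ht Hr Hle.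
  assert (K1 := kappa_ge1 t Ht).
  assert (HCk : 0 <= C * kappa t) by nra.
  assert (A := kappa_mono r _ Hr Hle).
  assert (B := kappa_subadd t (C * kappa t) Ht HCk).
  assert (D := H _ HCk). nra.
Qed.

(** Here the error involves [t], the quantity to be bounded. Sublinearity with a small slope gives
    [C * kappa t <= t / 2 + C * C1], so that [t] is at most [2 * s] plus a constant. *)
Lemma kappa_perturb_inv C :
  0 <= C -> exists C', 1 <= C' /\
    forall t s, 0 <= t -> 0 <= s -> t <= s + C * kappa t -> kappa t <= C' * kappa s.
Proof.
  intro HC.
  assert (He : 0 < / (2 * (C + 1))) by (apply Rinv_0_lt_compat; lra).
  destruct (kappa_affine_bound _ He) as [C1 [HC1 H]].
  assert (HCC : 0 <= 2 * C * C1) by nra.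
  assert (K2 := kappa_ge1 _ HCC).
  exists (2 + kappa (2 * C * C1)). split; [lra |]. intros t s Ht Hs Hle.
  assert (K1 := kappa_ge1 s Hs).
  assert (Hhalf : C * / (2 * (C + 1)) <= / 2).
  { rewrite Rinv_mult. assert (C * / (C + 1) <= 1); [| lra].
    apply Rmult_le_reg_r with (C + 1); [lra |].
    rewrite Rmult_assoc, Rinv_l by lra. lra. }
  assert (A := H t Ht).
  assert (A' : C * kappa t <= C * (/ (2 * (C + 1)) * t + C1)) by nra.
  assert (Hb : t <= 2 * s + 2 * C * C1) by nra.
  assert (B := kappa_mono t _ Ht Hb).
  assert (D := kappa_subadd (2 * s) _ ltac:(lra) HCC).
  assert (E := kappa_scale 2 s ltac:(lra) Hs). nra.
Qed.

End Kappa.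

Section Space.

Variable X : Type.
Variable d : X -> X -> R.
Variable o : X.
Variable kappa : R -> R.
Hypothesis Hmet : is_metric d.
Hypothesis Hk : kappa_ok kappa.

Lemma dist_ge0 x y : 0 <= d x y.
Proof. apply Hmet. Qed.

Lemma dist_refl x : d x x = 0.
Proof. apply Hmet. reflexivity. Qed.

Lemma dist_eq0 x y : d x y = 0 -> x = y.
Proof. apply Hmet. Qed.

Lemma dist_sym x y : d x y = d y x.
Proof. apply Hmet. Qed.

Lemma dist_tri x y z : d x z <= d x y + d y z.
Proof. apply Hmet. Qed.

Lemma kappa_norm_ge1 x : 1 <= kappa (d o x).
Proof. apply kappa_ge1; [exact Hk | apply dist_ge0]. Qed.

(** * Neighbourhoods and nearest points *)

(* Unlike [Nbhd], this asks for a witness and not only for a bound on the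
   infimum; as [1 <= kappa] the two differ by 1 in the constant. *)
Definition near (Z : X -> Prop) (n : R) (x : X) : Prop :=
  exists z, Z z /\ d x z <= n * kappa (d o x).

Lemma dist_set_exists (Z : X -> Prop) x z : Z z -> exists r, dist_set d Z x r.
Proof.
  intro Hz.
  destruct (completeness (fun r => exists z, Z z /\ r = - d x z)) as [m [H1 H2]].
  - exists 0. intros r [w [_ ->]]. assert (H := dist_ge0 x w). lra.
  - exists (- d x z), z. auto.
  - exists (- m). split.
    + intros v [w [Hw ->]]. assert (- d x w <= m); [| lra].
      apply H1. exists w. auto.
    + intros r Hr. assert (m <= - r); [| lra].
      apply H2. intros v [w [Hw ->]].
      assert (r <= d x w); [| lra]. apply Hr. exists w. auto.
Qed.

Lemma Nbhd_near Z n x : Nbhd d o kappa Z n x -> near Z (n + 1) x.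
Proof.
  intros [r [[_ Hr] Hn]]. apply NNPP. intro Hno.
  assert (H1 := kappa_norm_ge1 x).
  assert (n * kappa (d o x) + 1 <= r); [| lra].
  apply Hr. intros v [z [Hz ->]].
  destruct (Rle_or_lt (n * kappa (d o x) + 1) (d x z)) as [|Hlt]; [assumption |].
  exfalso. apply Hno. exists z. split; [exact Hz | lra].
Qed.

Lemma near_Nbhd (Z : X -> Prop) n x : near Z n x -> Nbhd d o kappa Z n x.
Proof.
  intros [z [Hz Hn]]. destruct (dist_set_exists Z x z Hz) as [r Hr].
  exists r. split; [exact Hr |]. apply Rle_trans with (d x z); [| exact Hn].
  apply Hr. exists z. auto.
Qed.

Lemma near_weaken (Z : X -> Prop) n n' x : n <= n' -> near Z n x -> near Z n' x.
Proof.
  intros Hn [z [Hz H]]. exists z. split; [exact Hz |].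
  assert (H1 := kappa_norm_ge1 x). nra.
Qed.

Lemma near_shift (Z : X -> Prop) n m :
  0 <= n -> 0 <= m -> exists N, 0 <= N /\
    forall x y, d x y <= m * kappa (d o x) -> near Z n y -> near Z N x.
Proof.
  intros Hn Hm. destruct (kappa_perturb kappa Hk m Hm) as [C [HC H]].
  exists (m + n * C). split; [nra |]. intros x y Hxy [z [Hz Hyz]].
  exists z. split; [exact Hz |].
  assert (A := dist_tri x y z). assert (B := dist_tri o x y).
  assert (D := H (d o x) (d o y) (dist_ge0 _ _) (dist_ge0 _ _) ltac:(lra)).
  nra.
Qed.

Lemma near_trans (Z W : X -> Prop) n m :
  0 <= n -> 0 <= m -> (forall z, Z z -> near W m z) ->
  exists N, 0 <= N /\ forall x, near Z n x -> near W N x.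
Proof.
  intros Hn Hm H. destruct (near_shift W m n Hm Hn) as [N [HN HN']].
  exists N. split; [exact HN |]. intros x [z [Hz Hxz]]. apply (HN' x z Hxz). auto.
Qed.

Definition proximinal (Z : X -> Prop) : Prop := forall x, exists p, proj_pt d Z x p.

Lemma proj_pt_le (Z : X -> Prop) x p z : proj_pt d Z x p -> Z z -> d x p <= d x z.
Proof. intros [_ [H _]] Hz. apply H. exists z. auto. Qed.

Lemma proj_pt_intro (Z : X -> Prop) x p :
  Z p -> (forall z, Z z -> d x p <= d x z) -> proj_pt d Z x p.
Proof.
  intros Hp H. split; [exact Hp |]. split.
  - intros v [z [Hz ->]]. auto.
  - intros r Hr. apply Hr. exists p. auto.
Qed.

Lemma proj_pt_self (Z : X -> Prop) z : Z z -> proj_pt d Z z z.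
Proof. intro Hz. apply proj_pt_intro; [exact Hz |]. intros. rewrite dist_refl. apply dist_ge0. Qed.

(** * Contracting sets *)

(** Only a projection of [x] is compared with one of [y]; for proximinal sets this agrees with the
    diameter bound up to a factor 2, through a projection of the other point. *)
Definition contracts (Z : X -> Prop) (c : R) : Prop :=
  forall x y p p', proj_pt d Z x p -> proj_pt d Z y p' -> d x y <= d x p ->
    d p p' <= c * kappa (d o x).

Lemma kappa_contracting_contracts Z :
  kappa_contracting d o kappa Z -> exists c, 0 <= c /\ contracts Z c.
Proof.
  intros [c Hc]. exists (Rabs c). split; [apply Rabs_pos |].
  intros x y p p' Hp Hp' Hxy.
  assert (H := Hc x y (ex_intro _ _ (conj (proj2 Hp) Hxy)) p p' (or_introl Hp) (or_intror Hp')).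
  assert (H1 := kappa_norm_ge1 x). assert (H2 := Rle_abs c). nra.
Qed.

Lemma contracts_kappa_contracting Z c :
  0 <= c -> proximinal Z -> contracts Z c -> kappa_contracting d o kappa Z.
Proof.
  intros Hc HZ H. exists (2 * c). intros x y [r [[Hr _] Hxy]] p1 p2 H1 H2.
  destruct (HZ x) as [p Hp]. destruct (HZ y) as [p' Hp'].
  assert (Hd : forall p, proj_pt d Z x p -> d x y <= d x p).
  { intros w [Hw _]. apply Rle_trans with r; [exact Hxy |]. apply Hr. exists w. auto. }
  assert (Hxy' : forall a b, proj_pt d Z x a -> proj_pt d Z y b ->
                 d a b <= c * kappa (d o x)) by (intros a b Ha Hb; apply (H x y); auto).
  assert (HK := kappa_norm_ge1 x).
  destruct H1 as [H1|H1], H2 as [H2|H2].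
  - assert (A := Hxy' _ _ H1 Hp'). assert (B := Hxy' _ _ H2 Hp').
    rewrite dist_sym in B. assert (T := dist_tri p1 p' p2). lra.
  - assert (A := Hxy' _ _ H1 H2). nra.
  - assert (A := Hxy' _ _ H2 H1). rewrite dist_sym. nra.
  - assert (A := Hxy' _ _ Hp H1). assert (B := Hxy' _ _ Hp H2).
    rewrite dist_sym in A. assert (T := dist_tri p1 p p2). lra.
Qed.

Lemma proj_pt_norm (Z : X -> Prop) x p : Z o -> proj_pt d Z x p -> d x p <= d o x.
Proof. intros Ho Hp. rewrite (dist_sym o x). apply (proj_pt_le Z); assumption. Qed.

(** If [y] is beyond the reach of contraction, then [d x p < d x y] and [d y p' <= 2 * d x y], so
    the path through [p], [x], [y], [p'] has length at most [4 * d x y]. *)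
Lemma contracts_coarse_lipschitz Z c x y p p' :
  0 <= c -> contracts Z c -> proj_pt d Z x p -> proj_pt d Z y p' ->
  d p p' <= c * kappa (d o x) + 4 * d x y.
Proof.
  intros Hc H Hp Hp'.
  assert (K1 := kappa_norm_ge1 x). assert (Hxy := dist_ge0 x y).
  destruct (Rle_or_lt (d x y) (d x p)) as [Hle|Hlt].
  - assert (A := H x y p p' Hp Hp' Hle). lra.
  - assert (A := proj_pt_le Z y p' p Hp' (proj1 Hp)).
    assert (T1 := dist_tri y x p). assert (T2 := dist_tri p x p').
    assert (T3 := dist_tri x y p'). rewrite (dist_sym p x) in T2.
    rewrite (dist_sym y x) in T1.
    assert (0 <= c * kappa (d o x)) by nra. lra.
Qed.

Hypothesis Hgeo : geodesic_space d.

(* Replace [y] by the point [w] of the geodesic [x, y] at distance [d(x, Z)]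
   from [x], to which contraction applies. *)
Lemma contracts_excess Z c x y p p' e :
  Z o -> proximinal Z -> 0 <= c -> contracts Z c -> 0 <= e ->
  proj_pt d Z x p -> proj_pt d Z y p' -> d x y <= d x p + e ->
  d p p' <= 3 * c * kappa (d o x) + 4 * e.
Proof.
  intros Ho HZ Hc H He Hp Hp' Hxy.
  assert (K1 := kappa_norm_ge1 x).
  destruct (Rle_or_lt (d x y) (d x p)) as [Hle|Hlt].
  { assert (A := H x y p p' Hp Hp' Hle). nra. }
  assert (Hxp := dist_ge0 x p).
  destruct (Hgeo x y) as [s [[_ Hs] [Hs0 Hs1]]].
  set (w := s (d x p)).
  assert (Hxw : d x w = d x p).
  { unfold w. rewrite <- Hs0 at 1. rewrite Hs by lra.
    rewrite Rabs_left1; lra. }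
  assert (Hwy : d w y <= e).
  { unfold w. rewrite <- Hs1 at 1. rewrite Hs by lra.
    rewrite Rabs_left1; lra. }
  destruct (HZ w) as [pw Hpw].
  assert (A := H x w p pw Hp Hpw ltac:(lra)).
  assert (B := contracts_coarse_lipschitz Z c w y pw p' Hc H Hpw Hp').
  assert (N1 := proj_pt_norm Z x p Ho Hp).
  assert (N2 := dist_tri o x w).
  assert (D : kappa (d o w) <= 2 * kappa (d o x)).
  { apply Rle_trans with (kappa (2 * d o x)).
    - apply kappa_mono; [exact Hk | apply dist_ge0 | lra].
    - apply kappa_scale; [exact Hk | lra | apply dist_ge0]. }
  assert (T := dist_tri p pw p'). nra.
Qed.

Lemma contracting_invariant Z W n m :
  Z o -> W o -> proximinal Z -> proximinal W -> 0 <= n -> 0 <= m ->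
  (forall z, Z z -> near W n z) -> (forall w, W w -> near Z m w) ->
  kappa_contracting d o kappa Z -> kappa_contracting d o kappa W.
Proof.
  intros HoZ HoW HZ HW Hn Hm HZW HWZ HcZ.
  destruct (kappa_contracting_contracts Z HcZ) as [c [Hc H]].
  assert (K2 : forall a r x, 1 <= a -> 0 <= r -> r <= a * d o x ->
               kappa r <= a * kappa (d o x)).
  { intros a r x Ha Hr Hle. apply Rle_trans with (kappa (a * d o x)).
    - apply kappa_mono; assumption.
    - apply kappa_scale; [exact Hk | exact Ha | apply dist_ge0]. }
  assert (HWdist : forall x p q, proj_pt d W x p -> proj_pt d Z x q ->
            d x p <= d x q + 2 * n * kappa (d o x)).
  { intros x p q Hp Hq. destruct (HZW q (proj1 Hq)) as [w [Hw Hqw]].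
    assert (A := proj_pt_le W x p w Hp Hw). assert (T := dist_tri x q w).
    assert (N := proj_pt_norm Z x q HoZ Hq). assert (N' := dist_tri o x q).
    assert (D := K2 2 (d o q) x ltac:(lra) (dist_ge0 _ _) ltac:(lra)). nra. }
  set (C1 := 3 * c + 8 * n + 10 * m).
  assert (HC1 : 0 <= C1) by (unfold C1; lra).
  (* A point [z] of [Z] near [p] is its own projection and almost as near to [x] as [q] is;
     [contracts_excess] with [z] in the place of [y] compares it with [q]. *)
  assert (Hclose : forall x p q, proj_pt d W x p -> proj_pt d Z x q ->
            d p q <= C1 * kappa (d o x)).
  { intros x p q Hp Hq. destruct (HWZ p (proj1 Hp)) as [z [Hz Hpz]].
    assert (A := HWdist x p q Hp Hq).
    assert (N := proj_pt_norm W x p HoW Hp). assert (N' := dist_tri o x p).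
    assert (D := K2 2 (d o p) x ltac:(lra) (dist_ge0 _ _) ltac:(lra)).
    assert (T := dist_tri x p z). assert (K1 := kappa_norm_ge1 x).
    assert (E0 : 0 <= (2 * n + 2 * m) * kappa (d o x)) by nra.
    assert (E := contracts_excess Z c x z q z ((2 * n + 2 * m) * kappa (d o x))
                   HoZ HZ Hc H E0 Hq (proj_pt_self Z z Hz) ltac:(nra)).
    assert (T' := dist_tri p z q). rewrite (dist_sym z q) in T'.
    unfold C1. nra. }
  apply contracts_kappa_contracting with (2 * C1 + C1 + 3 * c + 8 * n); [unfold C1; lra | exact HW |].
  intros x y p p' Hp Hp' Hxy.
  destruct (HZ x) as [q Hq]. destruct (HZ y) as [q' Hq'].
  assert (A := Hclose x p q Hp Hq). assert (B := Hclose y p' q' Hp' Hq').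
  assert (N := proj_pt_norm W x p HoW Hp). assert (N' := dist_tri o x y).
  assert (D := K2 2 (d o y) x ltac:(lra) (dist_ge0 _ _) ltac:(lra)).
  assert (E1 := HWdist x p q Hp Hq). assert (K1 := kappa_norm_ge1 x).
  assert (E0 : 0 <= 2 * n * kappa (d o x)) by nra.
  assert (E := contracts_excess Z c x y q q' _ HoZ HZ Hc H E0 Hq Hq' ltac:(lra)).
  assert (T1 := dist_tri p q p'). assert (T2 := dist_tri q q' p').
  rewrite (dist_sym q' p') in T2. nra.
Qed.

(** * Contracting sets are Morse *)

(* Since a quasi-geodesic moves by at most [q * sigma + Q] in time [sigma], from a
   far point [x] one may advance by [sigma = (d(x, Z) - Q) / q], while the
   projection moves by at most [c * kappa x <= (c / K) * d(x, Z)]. *)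
Lemma contracts_drift Z c g q Q K B N : forall s t p p',
  proximinal Z -> 0 <= c -> contracts Z c -> 1 <= q -> 0 <= Q -> 1 <= K -> 2 * Q <= K ->
  s <= t -> t - s <= INR N * (K / (2 * q)) ->
  qg_ineq d g q Q (fun r => s <= r <= t) ->
  (forall r p, s <= r <= t -> proj_pt d Z (g r) p -> K * kappa (d o (g r)) <= d (g r) p) ->
  (forall r, s <= r <= t -> kappa (d o (g r)) <= B) ->
  proj_pt d Z (g s) p -> proj_pt d Z (g t) p' ->
  d p p' <= 2 * c * q / K * (t - s) + c * B.
Proof.
  induction N as [|N IH]; intros s t p p' HZ Hc H Hq HQ HK HKQ Hst Hlen Hg Hfar HB Hp Hp'.
  - simpl in Hlen. assert (t = s) by lra. subst t.
    assert (A := H (g s) (g s) p p' Hp Hp' ltac:(rewrite dist_refl; apply dist_ge0)).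
    assert (E := HB s ltac:(lra)). nra.
  - set (D := d (g s) p).
    assert (HD : K * kappa (d o (g s)) <= D) by (apply Hfar; [lra | exact Hp]).
    assert (K1 := kappa_norm_ge1 (g s)).
    assert (HDK : K <= D) by nra.
    set (sg := (D - Q) / q).
    assert (Hsg : q * sg = D - Q) by (unfold sg; field; lra).
    assert (Hcoef : 0 <= 2 * c * q / K).
    { apply Rmult_le_pos; [nra | left; apply Rinv_0_lt_compat; lra]. }
    assert (EB := HB s ltac:(lra)).
    destruct (Rle_or_lt (t - s) sg) as [Hle|Hlt].
    (* Less than [sg] remains: one contraction finishes, at the cost [c * B]. In the other case the
       advance by [sg >= K / (2 * q)] uses up one unit of [N]. *)
    + assert (Hd : d (g s) (g t) <= D).
      { destruct (Hg s t ltac:(lra) ltac:(lra)) as [_ U].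
        rewrite Rabs_left1 in U by lra. nra. }
      assert (A := H _ _ p p' Hp Hp' Hd).
      assert (0 <= 2 * c * q / K * (t - s)) by (apply Rmult_le_pos; lra). nra.
    + assert (Hsg0 : K / (2 * q) <= sg).
      { apply Rmult_le_reg_l with (2 * q); [lra |].
        replace (2 * q * (K / (2 * q))) with K by (field; lra). lra. }
      assert (Hsgp : 0 < sg).
      { apply Rlt_le_trans with (K / (2 * q)); [| exact Hsg0].
        apply Rdiv_lt_0_compat; lra. }
      destruct (HZ (g (s + sg))) as [w Hw].
      assert (Hd : d (g s) (g (s + sg)) <= D).
      { destruct (Hg s (s + sg) ltac:(lra) ltac:(lra)) as [_ U].
        rewrite Rabs_left1 in U by lra. lra. }
      assert (A := H _ _ p w Hp Hw Hd).
      assert (A' : d p w <= 2 * c * q / K * sg).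
      { apply Rle_trans with (c * (D / K)).
        - apply Rle_trans with (1 := A). apply Rmult_le_compat_l; [exact Hc |].
          apply Rmult_le_reg_r with K; [lra |]. unfold Rdiv.
          rewrite Rmult_assoc, Rinv_l by lra. lra.
        - replace (2 * c * q / K * sg) with (c * (2 * (q * sg) / K)) by (field; lra).
          rewrite Hsg. apply Rmult_le_compat_l; [exact Hc |].
          apply Rmult_le_compat_r; [left; apply Rinv_0_lt_compat; lra | lra]. }
      rewrite S_INR in Hlen.
      assert (I := IH (s + sg) t w p' HZ Hc H Hq HQ HK HKQ ltac:(lra) ltac:(lra)).
      assert (I' : d w p' <= 2 * c * q / K * (t - (s + sg)) + c * B).
      { apply I; try assumption.
        - intros a b Ha Hb. apply Hg; lra.
        - intros r v Hr. apply Hfar. lra.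
        - intros r Hr. apply HB. lra. }
      assert (T := dist_tri p w p'). lra.
Qed.

Lemma contracting_excursion Z c q Q :
  proximinal Z -> 0 <= c -> contracts Z c -> 1 <= q -> 0 <= Q ->
  exists m, 0 <= m /\ forall g a b, qg_segment d g q Q a b -> Z (g a) -> Z (g b) ->
    forall t, a <= t <= b -> near Z m (g t).
Proof.
  intros HZ Hc H Hq HQ.
  (* The threshold for being far from [Z], large enough for the drift rate [2 * c * q / K] to be at
     most [/ (4 * q)]. *)
  set (K := 8 * c * (q * q) + 2 * Q + 1).
  assert (Hqq : 1 <= q * q) by nra.
  assert (HK : 1 <= K) by (unfold K; nra).
  assert (HKQ : 2 * Q <= K) by (unfold K; nra).
  (* With this slope, [q * (2 * K + c) * B] contains only a quarter of the length [l] of the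
     excursion. *)
  set (eta := / (4 * (q * q) * (2 * K + c))).
  assert (Heta : 0 < eta) by (apply Rinv_0_lt_compat; nra).
  assert (Heta' : (2 * K + c) * eta * (q * q) = / 4) by (unfold eta; field; nra).
  assert (Hrate : 2 * c * q / K <= / (4 * q)).
  { apply Rmult_le_reg_r with (4 * q * K); [nra |].
    replace (2 * c * q / K * (4 * q * K)) with (8 * c * (q * q)) by (field; lra).
    replace (/ (4 * q) * (4 * q * K)) with K by (field; lra). unfold K. lra. }
  destruct (kappa_affine_bound kappa Hk eta Heta) as [Ce [HCe Haff]].
  set (C2 := Ce + eta * (q + Q)).
  assert (HC2 : 0 <= C2) by (unfold C2; nra).
  set (C3 := 3 * Q + 2 * q + (2 * K + c) * (1 + C2)).
  assert (HC3 : 0 <= C3) by (unfold C3; nra).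
  set (L := 2 * q * C3).
  assert (HL : 0 <= L) by (unfold L; nra).
  set (m := q * (L + 1) + Q + K * (1 + C2 + eta * q * L)).
  assert (HKm : K <= m).
  { unfold m. assert (0 <= eta * q * L) by (apply Rmult_le_pos; nra).
    assert (0 <= K * (C2 + eta * q * L)) by (apply Rmult_le_pos; lra). nra. }
  exists m. split; [lra |].
  intros g a b [Hab [_ Hg]] Hga Hgb r Hr.
  set (good := fun s => exists p, proj_pt d Z (g s) p /\ d (g s) p <= K * kappa (d o (g s))).
  assert (Hend : forall s, Z (g s) -> good s).
  { intros s Hs. exists (g s). split; [apply proj_pt_self; exact Hs |].
    rewrite dist_refl. assert (K1 := kappa_norm_ge1 (g s)). nra. }
  destruct (classic (good r)) as [[p [Hp Hpr]]|Hbad].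
  { apply near_weaken with K; [exact HKm |]. exists p. split; [apply Hp | exact Hpr]. }
  (* Between [s1] and [t1] the quasi-geodesic is far from [Z]; the good times [s0] and [t0] are at
     most 1 away. *)
  destruct (last_before good a r ltac:(lra) (Hend a Hga) Hbad)
    as (s0 & s1 & S1 & S2 & S3 & S4 & [p0 [Hp0 Hp0']] & S6).
  destruct (first_after good r b ltac:(lra) (Hend b Hgb) Hbad)
    as (t1 & t0 & T1 & T2 & T3 & T4 & [p1 [Hp1 Hp1']] & T6).
  set (l := t1 - s1). assert (Hl : 0 <= l) by (unfold l; lra).
  set (k := kappa (d o (g r))). assert (Hk1 : 1 <= k) by apply kappa_norm_ge1.
  set (B := k + C2 + eta * q * l).
  assert (HB : forall s, s0 <= s <= t0 -> kappa (d o (g s)) <= B).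
  { intros s Hs. assert (Hsr : d (g r) (g s) <= q * (l + 1) + Q).
    { destruct (Hg r s ltac:(lra) ltac:(lra)) as [_ U].
      assert (Rabs (r - s) <= l + 1) by (apply Rabs_le; unfold l; lra). nra. }
    assert (Hpos : 0 <= q * (l + 1) + Q) by nra.
    assert (E1 := kappa_mono kappa Hk (d o (g s)) (d o (g r) + (q * (l + 1) + Q))
              (dist_ge0 _ _) ltac:(pose proof (dist_tri o (g r) (g s)); lra)).
    assert (E2 := kappa_subadd kappa Hk (d o (g r)) _ (dist_ge0 _ _) Hpos).
    assert (E3 := Haff _ Hpos). unfold B, C2, k. lra. }
  assert (HB1 : 1 <= B).
  { apply Rle_trans with (1 := Hk1). apply HB. lra. }
  destruct (HZ (g s1)) as [ps Hps]. destruct (HZ (g t1)) as [pt Hpt].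
  assert (Ds : d (g s1) ps <= q + Q + K * B).
  { assert (A := proj_pt_le Z _ ps p0 Hps (proj1 Hp0)).
    assert (T := dist_tri (g s1) (g s0) p0).
    destruct (Hg s1 s0 ltac:(lra) ltac:(lra)) as [_ U].
    rewrite Rabs_right in U by lra. assert (E := HB s0 ltac:(lra)). nra. }
  assert (Dt : d (g t1) pt <= q + Q + K * B).
  { assert (A := proj_pt_le Z _ pt p1 Hpt (proj1 Hp1)).
    assert (T := dist_tri (g t1) (g t0) p1).
    destruct (Hg t1 t0 ltac:(lra) ltac:(lra)) as [_ U].
    rewrite Rabs_left1 in U by lra. assert (E := HB t0 ltac:(lra)). nra. }
  assert (Hdrift : d ps pt <= 2 * c * q / K * l + c * B).
  { assert (Hstep : 0 < K / (2 * q)) by (apply Rdiv_lt_0_compat; lra).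
    destruct (INR_archimed (K / (2 * q)) (t1 - s1) Hstep) as [N HN].
    apply (contracts_drift Z c g q Q K B N); try assumption; try lra.
    - intros u v Hu Hv. apply Hg; lra.
    - intros u p Hu Hp. apply Rnot_lt_le. intro Hlt.
      assert (Hgood : good u) by (exists p; split; [exact Hp | lra]).
      destruct (Rle_or_lt u r) as [Hur|Hur].
      + apply (S6 u); [lra | exact Hgood].
      + apply (T6 u); [lra | exact Hgood].
    - intros u Hu. apply HB. lra. }
  assert (Hlow : / q * l - Q <= d (g s1) (g t1)).
  { destruct (Hg s1 t1 ltac:(lra) ltac:(lra)) as [U _].
    rewrite Rabs_left1 in U by lra. unfold Rdiv in U. rewrite Rmult_1_l in U.
    unfold l. replace (t1 - s1) with (- (s1 - t1)) by ring. exact U. }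
  (* The lower quasi-geodesic bound is set against the detour through [ps] and [pt]. After
     multiplication by [q], the drift and [B] contribute [l / 4] each, which leaves
     [l / 2 <= q * (C3 * k)]. *)
  assert (Hl2 : l <= L * k).
  { assert (V1 := dist_tri (g s1) ps (g t1)). assert (V2 := dist_tri ps pt (g t1)).
    rewrite (dist_sym pt (g t1)) in V2.
    assert (V3 : / q * l <= Q + 2 * (q + Q + K * B) + / (4 * q) * l + c * B).
    { assert (2 * c * q / K * l <= / (4 * q) * l) by (apply Rmult_le_compat_r; lra). lra. }
    assert (V4 : q * (/ q * l) <= q * (Q + 2 * (q + Q + K * B) + / (4 * q) * l + c * B))
      by (apply Rmult_le_compat_l; lra).
    replace (q * (/ q * l)) with l in V4 by (field; lra).
    replace (q * (Q + 2 * (q + Q + K * B) + / (4 * q) * l + c * B))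
      with (q * (3 * Q + 2 * q) + q * ((2 * K + c) * (k + C2)) + (2 * K + c) * eta * (q * q) * l + / 4 * l)
      in V4 by (unfold B; field; lra).
    rewrite Heta' in V4.
    assert (V5 : (2 * K + c) * (k + C2) <= (2 * K + c) * ((1 + C2) * k)).
    { apply Rmult_le_compat_l; [lra | nra]. }
    assert (V6 : 3 * Q + 2 * q <= (3 * Q + 2 * q) * k) by nra.
    assert (V7 : l / 2 <= q * (C3 * k)) by (unfold C3; nra).
    unfold L. lra. }
  exists p0. split; [apply Hp0 |]. fold k.
  assert (V1 := dist_tri (g r) (g s0) p0).
  destruct (Hg r s0 ltac:(lra) ltac:(lra)) as [_ U].
  rewrite Rabs_right in U by lra.
  assert (Hrs : r - s0 <= l + 1) by (unfold l; lra).
  assert (E := HB s0 ltac:(lra)).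
  assert (W1 : q * (r - s0) <= q * (L * k + 1)) by (apply Rmult_le_compat_l; lra).
  assert (W2 : B <= k + C2 + eta * q * (L * k)).
  { unfold B. assert (eta * q * l <= eta * q * (L * k)); [| lra].
    apply Rmult_le_compat_l; [nra | exact Hl2]. }
  assert (W3 : k + C2 + eta * q * (L * k) <= (1 + C2 + eta * q * L) * k) by nra.
  assert (W4 : K * kappa (d o (g s0)) <= K * ((1 + C2 + eta * q * L) * k)).
  { apply Rmult_le_compat_l; lra. }
  assert (W5 : q * (L * k + 1) <= q * (L + 1) * k) by nra.
  assert (W6 : Q <= Q * k) by nra.
  unfold m. lra.
Qed.

(* [kappa_Morse] also quantifies over [0 < q < 1]; such a quasi-geodesic is a
   [(1/q, Q)]-quasi-geodesic. *)
Lemma contracting_Morse Z :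
  proximinal Z -> kappa_contracting d o kappa Z -> kappa_Morse d o kappa Z.
Proof.
  intros HZ HcZ. destruct (kappa_contracting_contracts Z HcZ) as [c [Hc H]].
  assert (Hall : forall qQ : R * R, exists m, 0 <= m /\ (0 < fst qQ -> 0 <= snd qQ ->
    forall g a b, qg_segment d g (fst qQ) (snd qQ) a b -> Z (g a) -> Z (g b) ->
    forall t, a <= t <= b -> near Z m (g t))).
  { intros [q Q]. simpl.
    destruct (classic (0 < q /\ 0 <= Q)) as [[Hq HQ]|Hno].
    2: { exists 0. split; [lra |]. intros. exfalso. apply Hno. auto. }
    set (q' := Rmax q (/ q)).
    assert (Hqi : 0 < / q) by (apply Rinv_0_lt_compat; exact Hq).
    assert (A1 := Rmax_l q (/ q)). assert (A2 := Rmax_r q (/ q)). fold q' in A1, A2.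
    assert (Hq' : 1 <= q').
    { assert (q * / q = 1) by (apply Rinv_r; lra).
      apply Rnot_lt_le. intro. nra. }
    assert (A3 : / q' <= / q) by (apply Rinv_le_contravar; lra).
    destruct (contracting_excursion Z c q' Q HZ Hc H Hq' HQ) as [m [Hm Hm']].
    exists m. split; [exact Hm |]. intros _ _ g a b [Hab [Hcont Hg]].
    apply Hm'. split; [exact Hab |]. split; [exact Hcont |].
    intros s t Hs Ht. destruct (Hg s t Hs Ht) as [U1 U2].
    assert (U3 := Rabs_pos (s - t)). unfold Rdiv in *. rewrite Rmult_1_l in *. nra. }
  destruct (functional_choice _ Hall) as [m Hm].
  exists (fun q Q => m (q, Q)). split.
  - intros q Q. apply (Hm (q, Q)).
  - intros q Q Hq HQ g a b Hg Ha Hb t Ht. apply near_Nbhd.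
    destruct (Hm (q, Q)) as [_ Hm']. apply (Hm' Hq HQ g a b); assumption.
Qed.

(** * Comparison geometry *)

Hypothesis Hcat : CAT0_comparison d.

Lemma geodesic_from_start s L v : geodesic_segment d s L -> 0 <= v <= L -> d (s 0) (s v) = v.
Proof. intros [HL H] Hv. rewrite H by lra. rewrite Rabs_left1; lra. Qed.

Lemma geodesic_backward s L a :
  geodesic_segment d s L -> 0 <= a <= L -> geodesic_segment d (fun v => s (a - v)) a.
Proof.
  intros [HL H] Ha. split; [lra |]. intros u v Hu Hv. rewrite H by lra.
  rewrite <- Rabs_Ropp. f_equal. ring.
Qed.

(** The quotient divided by [u * v] is twice the cosine of the comparison angle at the common
    vertex; angle bounds appear in this form below. *)
Lemma cat0_hinge s1 s2 A B u v :
  geodesic_segment d s1 A -> geodesic_segment d s2 B -> s1 0 = s2 0 ->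
  0 < A -> 0 < B -> 0 <= u <= A -> 0 <= v <= B ->
  (d (s1 u) (s2 v)) ^ 2 <=
    u ^ 2 + v ^ 2 - u * v * (A ^ 2 + B ^ 2 - d (s1 A) (s2 B) ^ 2) / (A * B).
Proof.
  intros H1 H2 E HA HB Hu Hv.
  assert (D1 := geodesic_from_start s1 A A H1 ltac:(lra)).
  assert (D2 := geodesic_from_start s2 B B H2 ltac:(lra)).
  rewrite <- E in D2.
  assert (H := Hcat (s1 0) (s1 A) (s2 B) s1 s2). rewrite D1, D2 in H. apply H; auto.
Qed.

(* The angle at a nearest point is at least a right angle. *)
Lemma nearest_obtuse s B p :
  geodesic_segment d s B -> (forall v, 0 <= v <= B -> d p (s 0) <= d p (s v)) ->
  d p (s 0) ^ 2 + B ^ 2 <= d p (s B) ^ 2.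
Proof.
  intros Hs Hmin. assert (HB0 : 0 <= B) by apply Hs.
  assert (HA0 := dist_ge0 p (s 0)).
  destruct (Req_dec B 0) as [->|HBn]; [lra |].
  destruct (Req_dec (d p (s 0)) 0) as [HA|HAn].
  { apply dist_eq0 in HA. rewrite HA at 2. rewrite HA at 1. rewrite dist_refl.
    rewrite (geodesic_from_start s B B Hs) by lra. lra. }
  set (A := d p (s 0)) in *. set (C := d p (s B)).
  apply Rnot_lt_le. intro Hlt.
  destruct (Hgeo (s 0) p) as [s1 [H1 [E0 E1]]]. rewrite (dist_sym (s 0) p) in H1, E1.
  fold A in H1, E1.
  set (T := A ^ 2 + B ^ 2 - C ^ 2). assert (HT : 0 < T) by (unfold T; lra).
  assert (HTB : 0 < T / (2 * B)) by (apply Rdiv_lt_0_compat; lra).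
  (* [T] is positive if the angle is acute. Moving by [v] along [s] then lowers the squared distance
     to at most [A ^ 2 - v ^ 2], against minimality. *)
  set (v := Rmin B (T / (2 * B))).
  assert (Hv0 : 0 < v) by (apply Rmin_glb_lt; lra).
  assert (Hv1 : v <= B) by apply Rmin_l.
  assert (Hv2 : v <= T / (2 * B)) by apply Rmin_r.
  assert (K := cat0_hinge s1 s A B A v H1 Hs E0 ltac:(lra) ltac:(lra) ltac:(lra) ltac:(lra)).
  rewrite E1 in K. fold C in K. fold T in K.
  assert (M := Hmin v ltac:(lra)). fold A in M.
  replace (A * v * T / (A * B)) with (2 * v * (T / (2 * B))) in K by (field; lra).
  nra.
Qed.

Lemma nearest_on_geodesic s L p :
  geodesic_segment d s L ->
  exists t, 0 <= t <= L /\ forall v, 0 <= v <= L -> d p (s t) <= d p (s v).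
Proof.
  intros [HL Hs]. apply (continuous_attains_min (fun t => d p (s t)) 0 L HL).
  intros t Ht eps He. exists eps. split; [exact He |]. intros u Hu Hut.
  rewrite <- Hs in Hut by lra.
  assert (A := dist_tri p (s t) (s u)). assert (B := dist_tri p (s u) (s t)).
  rewrite (dist_sym (s t) (s u)) in A. apply Rabs_def1; lra.
Qed.

(** Past the parameter [T], the lower quasi-geodesic bound puts [g s] at distance at least
    [2 * d x o] from [o], hence no nearer to [x] than [o] is; a compact interval remains. *)
Lemma image_qg_ray_proximinal g : qg_ray d o g -> proximinal (image g).
Proof.
  intros (q & Q & Hq & HQ & H0 & Hc & Hg) x.
  set (T := q * (2 * d x o + Q)).
  assert (Hxo := dist_ge0 x o).
  assert (HT : 0 <= T) by (unfold T; nra).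
  destruct (continuous_attains_min (fun t => d x (g t)) 0 T HT) as [t [Ht Hmin]].
  - intros t Ht eps He. destruct (Hc t (proj1 Ht) eps He) as [del [Hd H]].
    exists del. split; [exact Hd |]. intros s Hs Hst.
    specialize (H s (proj1 Hs) Hst).
    assert (A := dist_tri x (g t) (g s)). assert (B := dist_tri x (g s) (g t)).
    rewrite (dist_sym (g t) (g s)) in A. apply Rabs_def1; lra.
  - exists (g t). apply proj_pt_intro.
    + exists t. split; [lra | reflexivity].
    + intros z [s [Hs <-]]. destruct (Rle_or_lt s T) as [Hle|Hlt]; [apply Hmin; lra |].
      apply Rle_trans with (d x (g 0)); [apply Hmin; lra |].
      destruct (Hg s 0 Hs (Rle_refl 0)) as [U _]. rewrite H0 in *.
      rewrite Rabs_right in U by lra.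
      assert (A := dist_tri (g s) x o). rewrite (dist_sym (g s) x) in A.
      assert (V : 2 * d x o + Q <= 1 / q * (s - 0)).
      { apply Rmult_le_reg_l with q; [lra |].
        replace (q * (1 / q * (s - 0))) with s by (field; lra). fold T. lra. }
      lra.
Qed.

(* The concatenation of the segment from [p] to its nearest point [s t] with the
   rest of [s] is a (3,0)-quasi-geodesic. *)
Lemma hinge_quasi_geodesic s L p t :
  geodesic_segment d s L -> 0 <= t <= L ->
  (forall v, 0 <= v <= L -> d p (s t) <= d p (s v)) ->
  exists z T, qg_segment d z 3 0 0 T /\ z 0 = p /\ z T = s L /\
    exists r, 0 <= r <= T /\ z r = s t.
Proof.
  intros Hs Ht Hmin. destruct (Hgeo p (s t)) as [g [Hg [g0 g1]]].
  set (r := d p (s t)) in *. assert (Hr : 0 <= r) by apply dist_ge0.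
  set (z := fun a => if Rle_dec a r then g a else s (t + (a - r))).
  assert (Z1 : forall a, a <= r -> z a = g a).
  { intros a Ha. unfold z. destruct (Rle_dec a r); [reflexivity | lra]. }
  assert (Z2 : forall a, r <= a -> z a = s (t + (a - r))).
  { intros a Ha. unfold z. destruct (Rle_dec a r); [| reflexivity].
    assert (a = r) by lra. subst a. rewrite g1. f_equal. ring. }
  set (T := r + (L - t)).
  assert (Hlt : forall a b, 0 <= a -> a <= b -> b <= T ->
            / 3 * (b - a) <= d (z a) (z b) <= b - a).
  { intros a b Ha Hab Hb. unfold T in Hb.
    destruct (Rle_or_lt b r) as [Hbr|Hbr].
    - rewrite !Z1 by lra. rewrite (proj2 Hg) by lra. rewrite Rabs_left1; lra.
    - destruct (Rle_or_lt r a) as [Har|Har].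
      + rewrite !Z2 by lra. rewrite (proj2 Hs) by lra. rewrite Rabs_left1; lra.
      (* Across the corner, with [u = r - a] and [v = b - r], the distance is at least [u], as [s t]
         is nearest to [p], and at least [v - u]; hence at least [(u + v) / 3]. *)
      + rewrite Z1, Z2 by lra.
        assert (M := Hmin (t + (b - r)) ltac:(lra)).
        assert (E1 : d (g a) (s t) = r - a).
        { rewrite <- g1. rewrite (proj2 Hg) by lra. rewrite Rabs_left1; lra. }
        assert (E2 : d (s t) (s (t + (b - r))) = b - r).
        { rewrite (proj2 Hs) by lra. rewrite Rabs_left1; lra. }
        assert (E3 : d p (g a) = a).
        { rewrite <- g0. apply (geodesic_from_start g r); [exact Hg | lra]. }
        assert (A1 := dist_tri (g a) (s t) (s (t + (b - r)))).
        assert (A2 := dist_tri p (g a) (s (t + (b - r)))).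
        assert (A3 := dist_tri (s t) (g a) (s (t + (b - r)))).
        rewrite (dist_sym (s t) (g a)) in A3. fold r in M. lra. }
  assert (Hz : forall a b, 0 <= a <= T -> 0 <= b <= T ->
            / 3 * Rabs (a - b) <= d (z a) (z b) <= Rabs (a - b)).
  { intros a b Ha Hb. destruct (Rle_or_lt a b) as [Hab|Hab].
    - rewrite Rabs_left1 by lra. replace (- (a - b)) with (b - a) by ring. apply Hlt; lra.
    - rewrite Rabs_right by lra. rewrite dist_sym. apply Hlt; lra. }
  exists z, T. repeat split.
  - unfold T; lra.
  - intros a Ha eps He. exists eps. split; [exact He |]. intros b Hb Hab.
    destruct (Hz b a Hb Ha). lra.
  - destruct (Hz s0 t0); try assumption. unfold Rdiv. rewrite Rmult_1_l. lra.
  - destruct (Hz s0 t0); try assumption. assert (P := Rabs_pos (s0 - t0)). lra.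
  - rewrite Z1; assumption.
  - rewrite Z2 by (unfold T; lra). f_equal. unfold T. ring.
  - exists r. split; [unfold T; lra |]. rewrite Z1 by lra. exact g1.
Qed.

Lemma proj_pt_along_geodesic (Z : X -> Prop) s D h :
  geodesic_segment d s D -> 0 <= h <= D -> proj_pt d Z (s D) (s 0) -> proj_pt d Z (s h) (s 0).
Proof.
  intros Hs Hh Hp. apply proj_pt_intro; [apply Hp |]. intros z Hz.
  assert (A := proj_pt_le Z _ _ z Hp Hz).
  rewrite dist_sym in A. rewrite (geodesic_from_start s D D Hs) in A by lra.
  rewrite dist_sym. rewrite (geodesic_from_start s D h Hs) by lra.
  assert (T := dist_tri (s D) (s h) z). rewrite (proj2 Hs D h) in T by lra.
  rewrite Rabs_right in T by lra. lra.
Qed.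

Lemma geodesic_ray_norm b t : geodesic_ray d o b -> 0 <= t -> d o (b t) = t.
Proof.
  intros [b0 H] Ht. rewrite <- b0. rewrite H by lra. rewrite Rabs_left1; lra.
Qed.

Lemma geodesic_ray_segment b t0 t1 :
  geodesic_ray d o b -> 0 <= t0 -> 0 <= t1 ->
  exists s, geodesic_segment d s (Rabs (t0 - t1)) /\ s 0 = b t0 /\ s (Rabs (t0 - t1)) = b t1 /\
    forall u, 0 <= u <= Rabs (t0 - t1) -> exists t, 0 <= t /\ s u = b t /\ Rabs (t0 - t) = u.
Proof.
  intros [_ Hb] H0 H1. destruct (Rle_or_lt t0 t1) as [Hle|Hlt].
  - rewrite Rabs_left1 by lra. exists (fun u => b (t0 + u)). repeat split.
    + lra.
    + intros u v Hu Hv. rewrite Hb by lra. f_equal. ring.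
    + f_equal. ring.
    + f_equal. ring.
    + intros u Hu. exists (t0 + u). repeat split; [lra |]. rewrite Rabs_left1; lra.
  - rewrite Rabs_right by lra. exists (fun u => b (t0 - u)). repeat split.
    + lra.
    + intros u v Hu Hv. rewrite Hb by lra. rewrite <- Rabs_Ropp. f_equal. ring.
    + f_equal. ring.
    + f_equal. ring.
    + intros u Hu. exists (t0 - u). repeat split; [lra |]. rewrite Rabs_right; lra.
Qed.

Lemma geodesic_ray_qg_ray b : geodesic_ray d o b -> qg_ray d o b.
Proof.
  intros [b0 H]. exists 1, 0. unfold ray_dom. repeat split; try lra; try assumption.
  - intros t Ht eps He. exists eps. split; [exact He |]. intros s Hs Hst. rewrite H; assumption.
  - rewrite H by assumption. lra.
  - rewrite H by assumption. lra.
Qed.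

(** * From Morse to contracting *)

(** The Morse property for the curves of [hinge_quasi_geodesic]; both [kappa_Morse] and [Morse_32]
    provide it. *)
Definition hinge_bounded (Z : X -> Prop) (M : R) : Prop :=
  forall z T, qg_segment d z 3 0 0 T -> Z (z 0) -> Z (z T) ->
    forall t, 0 <= t <= T -> near Z M (z t).

Section Ray.

Variables (b : R -> X) (Z : X -> Prop) (n M : R).
Hypothesis Hb : geodesic_ray d o b.
Hypothesis Hn : 0 <= n.
Hypothesis HM : 0 <= M.
Hypothesis HbZ : forall t, 0 <= t -> near Z n (b t).
Hypothesis HZb : forall z, Z z -> near (image b) n z.
Hypothesis HhZ : hinge_bounded Z M.

(* A right-angled isosceles triangle with legs [h], one of them on the ray, is
   almost degenerate: the nearest point [u] to the apex on the hypotenuse is the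
   turning point of a (3,0)-quasi-geodesic, hence close to the ray; so [u] is at
   distance at least [h - e] from [x], and the obtuse angle at [u] bounds its
   distance to the apex by [O(sqrt (h e))]. *)
Lemma isosceles_thin : exists C, 1 <= C /\ forall x t0 t1 h r,
  proj_pt d (image b) x (b t0) -> d x (b t0) = h -> Rabs (t0 - t1) = h ->
  0 <= t0 -> 0 <= t1 -> t0 + h <= r -> C * kappa r <= h ->
  3.8 * h ^ 2 <= d x (b t1) ^ 2.
Proof.
  destruct (near_trans Z (image b) M n HM Hn HZb) as [M' [HM' HZb']].
  destruct (kappa_perturb kappa Hk (2 * n) ltac:(lra)) as [C1 [HC1 Hpert]].
  set (E := n + M' * C1). assert (HE : 0 <= M' * C1) by nra.
  exists (5000 * E + 1). split; [unfold E; lra |].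
  intros x t0 t1 h r Hp Hh Ht Ht0 Ht1 Hr Hbig.
  assert (Hh0 : 0 <= h) by (rewrite <- Hh; apply dist_ge0).
  assert (Ht1r : t1 <= r) by (unfold Rabs in Ht; destruct (Rcase_abs _); lra).
  set (k := kappa r) in *.
  assert (Hk1 : 1 <= k) by (apply kappa_ge1; [exact Hk | lra]).
  set (e := E * k). assert (He0 : 0 <= e) by (unfold e, E; nra).
  assert (Hhe : 5000 * e <= h) by (unfold e; nra).
  assert (Hhp : 0 < h) by (unfold E in Hbig; nra).
  assert (Hnk : n * k <= e) by (unfold e, E; nra).
  (* The hinge must have its ends in [Z], so points [p1], [q1] of [Z] within [e] replace the
     vertices on the ray. *)
  destruct (HbZ t0 Ht0) as [p1 [Hp1 Dp1]]. destruct (HbZ t1 Ht1) as [q1 [Hq1 Dq1]].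
  rewrite geodesic_ray_norm in Dp1, Dq1 by assumption.
  assert (Kp := kappa_mono kappa Hk t0 r Ht0 ltac:(lra)).
  assert (Kq := kappa_mono kappa Hk t1 r Ht1 ltac:(lra)). fold k in Kp, Kq.
  assert (Dp1' : d (b t0) p1 <= n * k) by nra.
  assert (Dq1' : d (b t1) q1 <= n * k) by nra.
  destruct (Hgeo x q1) as [s [Hs [s0 s1]]]. set (L := d x q1) in *.
  destruct (nearest_on_geodesic s L p1 Hs) as [t [HtL Hmin]].
  destruct (hinge_quasi_geodesic s L p1 t Hs HtL Hmin) as (z & T & Hz & z0 & zT & w & Hw & zw).
  assert (Hu := HhZ z T Hz ltac:(rewrite z0; exact Hp1) ltac:(rewrite zT, s1; exact Hq1) w Hw).
  rewrite zw in Hu. destruct (HZb' _ Hu) as [u' [Hu' Du']].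
  set (u := s t) in *.
  assert (Hpu : d p1 u <= d p1 x) by (rewrite <- s0; apply Hmin; lra).
  assert (Dpx := dist_tri p1 (b t0) x). rewrite (dist_sym p1 (b t0)), (dist_sym (b t0) x) in Dpx.
  assert (Nu : d o u <= r + 2 * n * k).
  { assert (A1 := dist_tri o (b t0) u). assert (A2 := dist_tri (b t0) p1 u).
    rewrite geodesic_ray_norm in A1 by assumption. lra. }
  assert (Ku := Hpert r (d o u) ltac:(lra) (dist_ge0 _ _) Nu). fold k in Ku.
  assert (De : d u u' <= e).
  { apply Rle_trans with (M' * (C1 * k)); [nra |]. unfold e, E. nra. }
  assert (Hxu' := proj_pt_le _ _ _ u' Hp Hu'). rewrite Hh in Hxu'.
  assert (Hxu : h - e <= d x u) by (assert (A := dist_tri x u u'); lra).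
  assert (Exu : d x u = t).
  { rewrite <- s0. apply (geodesic_from_start s L); assumption. }
  assert (Euq : d u q1 = L - t).
  { unfold u. rewrite <- s1. rewrite (proj2 Hs) by lra. rewrite Rabs_left1; lra. }
  (* On the segment run backwards from [u] to [x], this gives [rho ^ 2 <= 4 * h * e], and
     [5000 * e <= h] turns it into [rho <= 0.029 * h]. *)
  assert (Hobt := nearest_obtuse (fun v => s (t - v)) t p1 (geodesic_backward s L t Hs HtL)).
  simpl in Hobt. rewrite Rminus_0_r, Rminus_diag, s0 in Hobt. fold u in Hobt.
  specialize (Hobt ltac:(intros v Hv; apply Hmin; lra)).
  set (rho := d p1 u) in *. assert (Hrho : 0 <= rho) by apply dist_ge0.
  assert (Hpx : d p1 x <= h + e) by lra. assert (Hpx0 := dist_ge0 p1 x).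
  assert (Hr2 : rho ^ 2 <= 4 * h * e).
  { assert (d p1 x ^ 2 <= (h + e) ^ 2) by (apply pow_incr; lra).
    assert ((h - e) ^ 2 <= t ^ 2) by (apply pow_incr; lra). lra. }
  assert (Hr3 : rho <= 0.029 * h).
  { apply Rnot_lt_le. intro Hlt. assert ((0.029 * h) ^ 2 < rho ^ 2) by nra. nra. }
  assert (Dpq : d (b t0) (b t1) = h) by (rewrite (proj2 Hb) by assumption; exact Ht).
  assert (A1 := dist_tri (b t0) p1 (b t1)). assert (A2 := dist_tri p1 q1 (b t1)).
  assert (A3 := dist_tri p1 u q1). assert (A4 := dist_tri x (b t1) q1).
  rewrite (dist_sym q1 (b t1)) in A2. fold L in A4. fold rho in A3.
  (* The point [u] splits the hypotenuse into parts of length at least [h - e] and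
     [h - 2 * e - rho]; replacing [q1] by [b t1] loses another [e]. *)
  assert (Hfin : 1.97 * h <= d x (b t1)) by lra.
  assert ((1.97 * h) ^ 2 <= d x (b t1) ^ 2) by (apply pow_incr; lra). nra.
Qed.

(** Cut both sides at [b t0] down to length [h]. The resulting isosceles triangle is almost
    degenerate, and the hinge inequality carries this back to the large comparison triangle: twice
    the cosine of its angle is at most -1.8. *)
Lemma projection_angle_wide : exists C, 1 <= C /\ forall x t0 t1 h r,
  proj_pt d (image b) x (b t0) -> 0 < h -> h <= d x (b t0) -> h <= Rabs (t0 - t1) ->
  0 <= t0 -> 0 <= t1 -> t0 + h <= r -> C * kappa r <= h ->
  let D := d x (b t0) in let l := Rabs (t0 - t1) in
  D ^ 2 + l ^ 2 + 1.8 * D * l <= d x (b t1) ^ 2.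
Proof.
  destruct isosceles_thin as [C [HC H]]. exists C. split; [exact HC |].
  intros x t0 t1 h r Hp Hh0 HhD Hhl Ht0 Ht1 Hr Hbig D l.
  fold D in HhD. fold l in Hhl.
  destruct (Hgeo (b t0) x) as [s1 [S1 [E1 E1']]]. rewrite (dist_sym (b t0) x) in S1, E1'.
  fold D in S1, E1'.
  destruct (geodesic_ray_segment b t0 t1 Hb Ht0 Ht1) as (s2 & S2 & E2 & E2' & S2').
  fold l in S2, E2', S2'.
  destruct (S2' h ltac:(lra)) as (t2 & Ht2 & Et2 & Dt2).
  assert (Hp' : proj_pt d (image b) (s1 h) (b t0)).
  { rewrite <- E1. apply (proj_pt_along_geodesic (image b) s1 D h S1 ltac:(lra)).
    rewrite E1', E1. exact Hp. }
  assert (Dh : d (s1 h) (b t0) = h).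
  { rewrite dist_sym, <- E1. apply (geodesic_from_start s1 D); [exact S1 | lra]. }
  assert (Low := H _ t0 t2 h r Hp' Dh Dt2 Ht0 Ht2 Hr Hbig).
  assert (Up := cat0_hinge s1 s2 D l h h S1 S2 ltac:(congruence)
     ltac:(lra) ltac:(lra) ltac:(lra) ltac:(lra)).
  rewrite E1', E2', Et2 in Up.
  set (W := D ^ 2 + l ^ 2 - d x (b t1) ^ 2) in *.
  assert (HW : W / (D * l) <= - 1.8).
  { replace (h * h * W / (D * l)) with (h ^ 2 * (W / (D * l))) in Up by (field; lra).
    assert (0 < h ^ 2) by nra. nra. }
  assert (HW' : W <= - 1.8 * (D * l)).
  { replace W with (W / (D * l) * (D * l)) by (field; lra).
    apply Rmult_le_compat_r; [nra | exact HW]. }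
  unfold W in HW'. lra.
Qed.

(* Write [p], [p'] for the projections of [x], [y], at distance [l]. If [l] is
   large, the comparison angles at [p] are wide, so the comparison angle between
   [p] and [x] at [p'] is small; as the one between [y] and [p] at [p'] is wide,
   the one between [x] and [y] is obtuse and [d x y > d x p' > d x p]. *)
Lemma geodesic_ray_contracting : kappa_contracting d o kappa (image b).
Proof.
  destruct isosceles_thin as [C0 [HC0 Hthin]].
  destruct projection_angle_wide as [C1 [HC1 Hwide]].
  set (C := Rmax C0 C1).
  assert (HCl : C0 <= C) by apply Rmax_l. assert (HCr : C1 <= C) by apply Rmax_r.
  assert (Hprox := image_qg_ray_proximinal b (geodesic_ray_qg_ray b Hb)).
  assert (Ho : image b o) by (exists 0; split; [lra | apply Hb]).
  (* [48 = 4 * 12]: beyond this bound, [h = l / 4] is at least [C * kappa r] for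
     [r = 12 * d o x]. *)
  apply contracts_kappa_contracting with (48 * C); [lra | exact Hprox |].
  intros x y p p' Hp Hp' Hxy.
  destruct (proj1 Hp) as [t0 [Ht0 <-]]. destruct (proj1 Hp') as [t1 [Ht1 <-]].
  set (D := d x (b t0)) in *. set (D' := d y (b t1)). set (N := d x (b t1)).
  set (l := Rabs (t0 - t1)).
  assert (El : d (b t0) (b t1) = l) by (apply (proj2 Hb); assumption).
  rewrite El.
  assert (NX := proj_pt_norm _ x _ Ho Hp). fold D in NX.
  assert (HD0 : 0 <= D) by apply dist_ge0. assert (HN0 : 0 <= N) by apply dist_ge0.
  assert (HD'0 : 0 <= D') by apply dist_ge0.
  assert (HX0 := dist_ge0 o x).
  assert (Nt0 : t0 <= 2 * d o x).
  { rewrite <- (geodesic_ray_norm b t0 Hb Ht0). assert (A := dist_tri o x (b t0)).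
    fold D in A. lra. }
  assert (Hl4 : l <= 4 * D).
  { assert (A1 := dist_tri (b t0) x (b t1)). assert (A2 := dist_tri x y (b t1)).
    assert (A3 := proj_pt_le _ _ _ (b t0) Hp' (proj1 Hp)).
    assert (A4 := dist_tri y x (b t0)). rewrite (dist_sym (b t0) x) in A1.
    rewrite (dist_sym y x) in A4. fold D in A1, A4. lra. }
  set (r := 12 * d o x).
  assert (Hr : kappa r <= 12 * kappa (d o x)) by (apply kappa_scale; [exact Hk | lra | lra]).
  assert (K1 : 1 <= kappa r) by (apply kappa_ge1; [exact Hk | unfold r; lra]).
  apply Rnot_lt_le. intro Hlt.
  set (h := l / 4).
  assert (Hh : C * kappa r <= h) by (unfold h; nra).
  assert (Hh0 : 0 < h) by nra.
  assert (Nt1 : t1 <= t0 + l).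
  { unfold l. assert (A := Rle_abs (- (t0 - t1))). rewrite Rabs_Ropp in A. lra. }
  assert (Hh1 : C1 * kappa r <= h) by (apply Rle_trans with (2 := Hh); apply Rmult_le_compat_r; lra).
  assert (Hhth : C0 * kappa r <= h) by (apply Rle_trans with (2 := Hh); apply Rmult_le_compat_r; lra).
  assert (Hlh : l = 4 * h) by (unfold h; lra).
  assert (HhD : h <= D) by lra. assert (Hhl : h <= l) by lra.
  assert (Hr0 : t0 + h <= r) by (unfold r; lra).
  assert (W := Hwide x t0 t1 h r Hp Hh0 HhD Hhl Ht0 Ht1 Hr0 Hh1).
  cbv zeta in W. fold D l N in W.
  assert (HND : D + 0.9 * l <= N).
  { apply Rnot_lt_le. intro Hc. assert (N ^ 2 < (D + 0.9 * l) ^ 2) by nra. nra. }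
  assert (HNl : N <= D + l) by (assert (A := dist_tri x (b t0) (b t1)); fold N D in A; lra).
  assert (HD' : h <= D').
  { assert (A := dist_tri x y (b t1)). fold N D' in A. unfold h. lra. }
  destruct (Hgeo (b t1) x) as [sx [Sx [Ex Ex']]]. rewrite (dist_sym (b t1) x) in Sx, Ex'.
  fold N in Sx, Ex'.
  destruct (Hgeo (b t1) y) as [sy [Sy [Ey Ey']]]. rewrite (dist_sym (b t1) y) in Sy, Ey'.
  fold D' in Sy, Ey'.
  destruct (geodesic_ray_segment b t1 t0 Hb Ht1 Ht0) as (sp & Sp & Ep & Ep' & Sp').
  rewrite Rabs_minus_sym in Sp, Ep', Sp'. fold l in Sp, Ep', Sp'.
  destruct (Sp' h ltac:(unfold h; lra)) as (t2 & Ht2 & Et2 & Dt2).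
  assert (U1 := cat0_hinge sx sp N l h h Sx Sp ltac:(congruence)
     ltac:(lra) ltac:(lra) ltac:(lra) ltac:(lra)).
  rewrite Ex', Ep' in U1. fold D in U1.
  assert (U1' : d (sx h) (sp h) ^ 2 <= 0.2 * h ^ 2).
  (* The comparison angle at [b t1] between [x] and [b t0] is small, by [W] and [N <= D + l]. *)
  { assert (V : 1.8 <= (N ^ 2 + l ^ 2 - D ^ 2) / (N * l)).
    { apply Rmult_le_reg_r with (N * l); [nra |].
      unfold Rdiv. rewrite Rmult_assoc, Rinv_l by nra. nra. }
    replace (h * h * (N ^ 2 + l ^ 2 - D ^ 2) / (N * l))
      with (h ^ 2 * ((N ^ 2 + l ^ 2 - D ^ 2) / (N * l))) in U1 by (field; lra).
    assert (0 < h ^ 2) by nra. nra. }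
  assert (Hpy : proj_pt d (image b) (sy h) (b t1)).
  { rewrite <- Ey. apply (proj_pt_along_geodesic (image b) sy D' h Sy ltac:(lra)).
    rewrite Ey', Ey. exact Hp'. }
  assert (Dy : d (sy h) (b t1) = h).
  { rewrite dist_sym, <- Ey. apply (geodesic_from_start sy D'); [exact Sy | lra]. }
  assert (U2 := Hthin (sy h) t1 t2 h r Hpy Dy Dt2 Ht1 Ht2 ltac:(unfold r; lra) Hhth).
  rewrite <- Et2 in U2.
  assert (V1 : d (sx h) (sp h) <= 0.448 * h).
  { apply Rnot_lt_le. intro Hc. assert ((0.448 * h) ^ 2 < d (sx h) (sp h) ^ 2) by nra. nra. }
  assert (V2 : 1.949 * h <= d (sy h) (sp h)).
  { apply Rnot_lt_le. intro Hc. assert (P := dist_ge0 (sy h) (sp h)).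
    assert (d (sy h) (sp h) ^ 2 < (1.949 * h) ^ 2) by nra. nra. }
  (* As [1.5 ^ 2 > 2], this makes the comparison angle at [b t1] between [x] and [y] obtuse, whereas
     [d x y <= D <= N] makes its cosine nonnegative. *)
  assert (V3 : 1.5 * h <= d (sx h) (sy h)).
  { assert (A := dist_tri (sy h) (sx h) (sp h)). rewrite (dist_sym (sy h) (sx h)) in A. lra. }
  assert (U3 := cat0_hinge sx sy N D' h h Sx Sy ltac:(congruence)
     ltac:(lra) ltac:(lra) ltac:(lra) ltac:(lra)).
  rewrite Ex', Ey' in U3.
  set (W3 := N ^ 2 + D' ^ 2 - d x y ^ 2) in *.
  assert (HW3 : W3 / (N * D') < 0).
  { replace (h * h * W3 / (N * D')) with (h ^ 2 * (W3 / (N * D'))) in U3 by (field; lra).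
    assert (0 < h ^ 2) by nra. nra. }
  assert (HW3' : 0 <= W3).
  { unfold W3. assert (P := dist_ge0 x y).
    assert (d x y ^ 2 <= N ^ 2) by (apply pow_incr; lra). nra. }
  assert (0 <= W3 / (N * D')).
  { apply Rmult_le_pos; [exact HW3' |]. left. apply Rinv_0_lt_compat. nra. }
  lra.
Qed.

End Ray.
(** * A geodesic ray in the class of a Morse quasi-geodesic ray *)

Hypothesis Hprop : proper_space d.

Lemma geodesic_restrict s L a :
  geodesic_segment d s L -> 0 <= a <= L -> geodesic_segment d s a.
Proof. intros [HL H] Ha. split; [lra |]. intros u v Hu Hv. apply H; lra. Qed.

(** In the isosceles comparison triangle with legs [r], the chord at time [t] is the base scaled by
    [t / r]. *)
Lemma cat0_diverge s1 s2 r t :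
  geodesic_segment d s1 r -> geodesic_segment d s2 r -> s1 0 = s2 0 ->
  0 < r -> 0 <= t <= r -> d (s1 t) (s2 t) <= t / r * d (s1 r) (s2 r).
Proof.
  intros H1 H2 E Hr Ht.
  assert (K := cat0_hinge s1 s2 r r t t H1 H2 E Hr Hr Ht Ht).
  set (c := d (s1 r) (s2 r)) in *.
  replace (t ^ 2 + t ^ 2 - t * t * (r ^ 2 + r ^ 2 - c ^ 2) / (r * r))
    with ((t / r * c) ^ 2) in K by (field; lra).
  apply Rsqr_incr_0.
  - unfold Rsqr. lra.
  - apply dist_ge0.
  - apply Rmult_le_pos; [| apply dist_ge0].
    apply Rmult_le_pos; [lra | left; apply Rinv_0_lt_compat; lra].
Qed.

Section Limit.

Variables (beta : R -> X) (q Q m : R).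
Hypothesis Hq : 1 <= q.
Hypothesis HQ : 0 <= Q.
Hypothesis Hm : 0 <= m.
Hypothesis Hbeta0 : beta 0 = o.
Hypothesis Hbeta : qg_ineq d beta q Q ray_dom.
Hypothesis HMorse : forall s L, geodesic_segment d s L -> s 0 = o -> image beta (s L) ->
  forall t, 0 <= t <= L -> near (image beta) m (s t).

Lemma ray_dist_bounds a c : 0 <= a -> a <= c ->
  c - a <= q * (d (beta a) (beta c) + Q) /\ d (beta a) (beta c) <= q * (c - a) + Q.
Proof.
  intros Ha Hac. destruct (Hbeta a c Ha ltac:(unfold ray_dom; lra)) as [U1 U2].
  rewrite Rabs_left1 in U1, U2 by lra. split; [| lra].
  replace (c - a) with (q * (1 / q * - (a - c))) by (field; lra).
  apply Rmult_le_compat_l; lra.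
Qed.

Lemma ray_norm_bound a : 0 <= a -> a <= q * (d o (beta a) + Q).
Proof.
  intro Ha. destruct (ray_dist_bounds 0 a (Rle_refl 0) Ha) as [U _].
  rewrite Hbeta0 in U. lra.
Qed.

(* While [t] runs from [0] to [L], the parameters of the points of [beta] close
   to [s t] run from [0] to [c], hence jump over [a] at some [t]. *)
Lemma ray_near_geodesic : exists C, 0 <= C /\ forall s L a c,
  geodesic_segment d s L -> s 0 = o -> s L = beta c -> 0 <= a <= c ->
  exists t, 0 <= t <= L /\ d (beta a) (s t) <= C * kappa (d o (beta a)).
Proof.
  destruct (kappa_perturb kappa Hk 1 Rle_0_1) as [C1 [HC1 Hp1]].
  (* In multiples of [kappa t1], [E] bounds the jump from [beta a1] to [beta a2], and [C2] the
     distance from [beta a1] to [beta a]. *)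
  set (E := m + 1 + m * C1). assert (HE : 0 <= E) by (unfold E; nra).
  set (C2 := q * (q * (E + Q)) + Q).
  assert (HC2 : 0 <= C2) by (unfold C2; assert (0 <= q * (E + Q)) by nra; nra).
  destruct (kappa_perturb_inv kappa Hk (C2 + m) ltac:(lra)) as [C3 [HC3 Hp3]].
  exists ((C2 + m) * C3). split; [nra |].
  intros s L a c Hs s0 sL Ha.
  assert (HL : 0 <= L) by apply Hs.
  assert (Hnorm : forall t, 0 <= t <= L -> d o (s t) = t).
  { intros t Ht. rewrite <- s0. apply (geodesic_from_start s L); assumption. }
  set (G := fun t => exists a', 0 <= a' <= a /\ d (s t) (beta a') <= m * kappa t).
  assert (Hjump : exists t1 t2 a1 a2, 0 <= t1 /\ t1 <= t2 /\ t2 <= L /\ t2 - t1 <= 1 /\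
            0 <= a1 <= a /\ a <= a2 /\
            d (s t1) (beta a1) <= m * kappa t1 /\ d (s t2) (beta a2) <= m * kappa t2).
  { destruct (classic (G L)) as [[a1 [Ha1 Da1]]|HnG].
    - exists L, L, a1, c. repeat split; try lra.
      rewrite sL, dist_refl. assert (K1 := kappa_ge1 kappa Hk L HL). nra.
    - assert (HG0 : G 0).
      { exists 0. split; [lra |]. rewrite s0, Hbeta0, dist_refl.
        assert (K1 := kappa_ge1 kappa Hk 0 (Rle_refl 0)). nra. }
      destruct (last_before G 0 L HL HG0 HnG)
        as (t1 & t2 & A1 & A2 & A3 & A4 & [a1 [Ha1 Da1]] & A6).
      destruct (HMorse s L Hs s0 ltac:(rewrite sL; exists c; split; [lra | reflexivity]) t2 ltac:(lra))
        as [z [[a2 [Ha2 <-]] Da2]].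
      rewrite Hnorm in Da2 by lra.
      exists t1, t2, a1, a2. repeat split; try lra.
      apply Rnot_lt_le. intro Hlt. apply (A6 t2 ltac:(lra)).
      exists a2. split; [lra | exact Da2]. }
  destruct Hjump as (t1 & t2 & a1 & a2 & H1 & H2 & H3 & H4 & H5 & H6 & H7 & H8).
  exists t1. split; [lra |].
  set (k := kappa t1) in *.
  assert (Hk1 : 1 <= k) by (apply kappa_ge1; assumption).
  assert (Kt2 := Hp1 t1 t2 H1 ltac:(lra) ltac:(fold k; lra)). fold k in Kt2.
  assert (Da : d (beta a1) (beta a2) <= E * k).
  { assert (A1 := dist_tri (beta a1) (s t1) (beta a2)).
    assert (A2 := dist_tri (s t1) (s t2) (beta a2)).
    rewrite (dist_sym (beta a1) (s t1)) in A1.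
    rewrite (proj2 Hs t1 t2), Rabs_left1 in A2 by lra.
    assert (m * kappa t2 <= m * (C1 * k)) by (apply Rmult_le_compat_l; assumption).
    unfold E. nra. }
  destruct (ray_dist_bounds a1 a2 ltac:(lra) ltac:(lra)) as [B1 _].
  destruct (ray_dist_bounds a1 a ltac:(lra) ltac:(lra)) as [_ B2].
  assert (B3 : d (beta a1) (beta a) <= C2 * k).
  { assert (B4 : q * (d (beta a1) (beta a2) + Q) <= q * ((E + Q) * k))
      by (apply Rmult_le_compat_l; nra).
    assert (B5 : q * (a - a1) <= q * (q * ((E + Q) * k))) by (apply Rmult_le_compat_l; lra).
    unfold C2. nra. }
  assert (B6 : d (beta a) (s t1) <= (C2 + m) * k).
  { assert (A := dist_tri (beta a) (beta a1) (s t1)).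
    rewrite (dist_sym (beta a) (beta a1)), (dist_sym (beta a1) (s t1)) in A. lra. }
  assert (B7 : t1 <= d o (beta a) + (C2 + m) * k).
  { rewrite <- (Hnorm t1) at 1 by lra. assert (A := dist_tri o (beta a) (s t1)). lra. }
  assert (B8 := Hp3 t1 _ H1 (dist_ge0 o (beta a)) B7). fold k in B8.
  rewrite Rmult_assoc. apply Rle_trans with (1 := B6).
  apply Rmult_le_compat_l; lra.
Qed.

(** [s r] is near some [beta a] with [a <= T <= c'], and [s'] passes near that point at some time
    [t]. Both geodesics start at [o], so [t] differs from [r] by at most the distance just found,
    whence the factor 2. *)
Lemma geodesics_to_ray_close : exists C, 0 <= C /\ forall r, 0 <= r -> exists T,
  forall s L s' L' c c', T <= c -> T <= c' ->
  geodesic_segment d s L -> s 0 = o -> s L = beta c ->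
  geodesic_segment d s' L' -> s' 0 = o -> s' L' = beta c' ->
  r <= L /\ r <= L' /\ d (s r) (s' r) <= C * kappa r.
Proof.
  destruct ray_near_geodesic as [C0 [HC0 Hback]].
  destruct (kappa_perturb kappa Hk m Hm) as [C1 [HC1 Hp1]].
  assert (HC01 : 0 <= C0 * C1) by nra.
  exists (2 * (m + C0 * C1)). split; [lra |]. intros r Hr.
  set (k := kappa r). assert (Hk1 : 1 <= k) by (apply kappa_ge1; assumption).
  set (T := q * (r + m * k + Q)).
  assert (HT : q * (r + Q) <= T) by (unfold T; apply Rmult_le_compat_l; nra).
  assert (HT0 : 0 <= T) by nra.
  assert (Hlen : forall s L c, T <= c -> geodesic_segment d s L -> s 0 = o -> s L = beta c -> r <= L).
  { intros s L c Hc Hs s0 sL.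
    assert (EL : d o (beta c) = L).
    { rewrite <- s0, <- sL. apply (geodesic_from_start s L); [exact Hs |].
      destruct Hs. lra. }
    assert (A := ray_norm_bound c ltac:(lra)). rewrite EL in A. nra. }
  exists T. intros s L s' L' c c' Hc Hc' Hs s0 sL Hs' s0' sL'.
  assert (HrL := Hlen s L c Hc Hs s0 sL). assert (HrL' := Hlen s' L' c' Hc' Hs' s0' sL').
  split; [exact HrL |]. split; [exact HrL' |].
  destruct (HMorse s L Hs s0 ltac:(rewrite sL; exists c; split; [lra | reflexivity]) r ltac:(lra))
    as [z [[a [Ha <-]] Da]].
  assert (Nr : d o (s r) = r) by (rewrite <- s0; apply (geodesic_from_start s L); [exact Hs | lra]).
  rewrite Nr in Da. fold k in Da |- *.
  assert (Na : d o (beta a) <= r + m * k).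
  { assert (A := dist_tri o (s r) (beta a)). lra. }
  assert (HaT : a <= T).
  { apply Rle_trans with (1 := ray_norm_bound a Ha). apply Rmult_le_compat_l; lra. }
  destruct (Hback s' L' a c' Hs' s0' sL' ltac:(lra)) as [t [Ht Dt]].
  assert (Ka := Hp1 r (d o (beta a)) Hr (dist_ge0 _ _) Na). fold k in Ka.
  assert (Dt' : d (beta a) (s' t) <= C0 * C1 * k).
  { rewrite Rmult_assoc. apply Rle_trans with (1 := Dt). apply Rmult_le_compat_l; assumption. }
  assert (A1 := dist_tri (s r) (beta a) (s' t)).
  assert (A2 := dist_tri (s r) (s' t) (s' r)).
  assert (Nt : d o (s' t) = t) by (rewrite <- s0'; apply (geodesic_from_start s' L'); [exact Hs' | lra]).
  assert (A3 := dist_tri o (s r) (s' t)). assert (A4 := dist_tri o (s' t) (s r)).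
  rewrite (dist_sym (s' t) (s r)) in A4. rewrite Nr, Nt in A3, A4.
  assert (A5 : d (s' t) (s' r) <= (m + C0 * C1) * k).
  { rewrite (proj2 Hs') by lra. apply Rabs_le. lra. }
  lra.
Qed.

Lemma geodesic_limit_ray : exists b, geodesic_ray d o b /\
  exists N, 0 <= N /\ (forall t, 0 <= t -> near (image beta) N (b t)) /\
    (forall z, image beta z -> near (image b) N z).
Proof.
  destruct ray_near_geodesic as [C0 [HC0 Hback]].
  destruct geodesics_to_ray_close as [C [HC Hclose]].
  destruct (functional_choice _ (fun n : nat => Hgeo o (beta (INR n)))) as [g Hg].
  set (len := fun n => d o (beta (INR n))).
  assert (Hg1 : forall n, geodesic_segment d (g n) (len n)) by apply Hg.
  assert (Hg2 : forall n, g n 0 = o) by apply Hg.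
  assert (Hg3 : forall n, g n (len n) = beta (INR n)) by apply Hg.
  assert (Hlarge : forall T, exists N, forall n, (N <= n)%nat -> T <= INR n).
  { intro T. destruct (INR_archimed 1 T Rlt_0_1) as [N HN]. exists N.
    intros n Hn. apply le_INR in Hn. lra. }
  assert (Hpair : forall r, 0 <= r -> exists N, forall n n', (N <= n)%nat -> (N <= n')%nat ->
            r <= len n /\ d (g n r) (g n' r) <= C * kappa r).
  { intros r Hr. destruct (Hclose r Hr) as [T HT]. destruct (Hlarge T) as [N HN].
    exists N. intros n n' Hn Hn'.
    destruct (HT (g n) (len n) (g n') (len n') (INR n) (INR n')) as (A1 & _ & A3); auto. }
  assert (Hpair' : forall r, 0 < r -> exists N, forall n n', (N <= n)%nat -> (N <= n')%nat ->
            r <= len n /\ forall t, 0 <= t <= r -> d (g n t) (g n' t) <= t / r * (C * kappa r)).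
  { intros r Hr. destruct (Hpair r ltac:(lra)) as [N HN]. exists N. intros n n' Hn Hn'.
    destruct (HN n n' Hn Hn') as [A1 A2]. destruct (HN n' n Hn' Hn) as [A3 _].
    split; [exact A1 |]. intros t Ht.
    apply Rle_trans with (t / r * d (g n r) (g n' r)).
    - apply cat0_diverge; try assumption.
      + apply geodesic_restrict with (len n); [apply Hg1 | lra].
      + apply geodesic_restrict with (len n'); [apply Hg1 | lra].
      + rewrite !Hg2. reflexivity.
    - apply Rmult_le_compat_l; [| exact A2].
      apply Rmult_le_pos; [lra | left; apply Rinv_0_lt_compat; exact Hr]. }
  assert (Hcauchy : forall t eps, 0 <= t -> 0 < eps -> exists N, forall n n',
            (N <= n)%nat -> (N <= n')%nat -> d (g n t) (g n' t) <= eps).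
  { intros t eps Ht He.
    assert (Hden : 0 < t * C + 1) by nra.
    destruct Hk as (_ & _ & _ & Hsub).
    destruct (Hsub (eps / (t * C + 1)) ltac:(apply Rdiv_lt_0_compat; lra)) as [T [HT Hsubl]].
    set (r := Rmax t T). assert (R1 : t <= r) by apply Rmax_l. assert (R2 : T <= r) by apply Rmax_r.
    destruct (Hpair' r ltac:(lra)) as [N HN]. exists N. intros n n' Hn Hn'.
    destruct (HN n n' Hn Hn') as [_ A]. specialize (A t ltac:(lra)).
    apply Rle_trans with (1 := A).
    assert (K := Hsubl r R2).
    assert (Kp : 1 <= kappa r) by (apply kappa_ge1; [exact Hk | lra]).
    apply Rmult_le_reg_r with r; [lra |].
    replace (t / r * (C * kappa r) * r) with (t * C * kappa r) by (field; lra).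
    apply Rle_trans with ((t * C + 1) * kappa r); [lra |].
    apply Rle_trans with ((t * C + 1) * (eps / (t * C + 1) * r)).
    - apply Rmult_le_compat_l; lra.
    - right. field. lra. }
  assert (Hlim : forall t, exists x, 0 <= t -> forall eps, 0 < eps -> exists N, forall n,
            (N <= n)%nat -> d (g n t) x <= eps).
  { intro t. destruct (Rle_or_lt 0 t) as [Ht|Ht]; [| exists o; intro; lra].
    destruct (Hcauchy t 1 Ht Rlt_0_1) as [N0 HN0].
    destruct (Hprop (g N0 t) 1 (fun n => g (N0 + n)%nat t)) as (phi & x & Hphi & _ & Hx).
    { intro n. apply HN0; lia. }
    assert (Hphi' : forall n, (n <= phi n)%nat).
    { induction n as [|n IH]; [lia |]. assert (A := Hphi n (S n) ltac:(lia)). lia. }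
    exists x. intros _ eps He.
    destruct (Hcauchy t (eps / 2) Ht ltac:(lra)) as [N1 HN1].
    destruct (Hx (eps / 2) ltac:(lra)) as [N2 HN2].
    exists N1. intros n Hn. set (j := (N1 + N2)%nat).
    assert (A1 := HN1 n (N0 + phi j)%nat Hn ltac:(specialize (Hphi' j); lia)).
    assert (A2 := HN2 j ltac:(lia)).
    assert (A3 := dist_tri (g n t) (g (N0 + phi j)%nat t) x). lra. }
  destruct (functional_choice _ Hlim) as [b Hb].
  assert (Hray : geodesic_ray d o b).
  { split.
    - apply dist_eq0. apply Rle_antisym; [| apply dist_ge0].
      apply le_epsilon. intros eps He.
      destruct (Hb 0 (Rle_refl 0) eps He) as [N HN]. specialize (HN N (le_n N)).
      rewrite Hg2, dist_sym in HN. lra.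
    - intros s t Hs Ht.
      assert (Happ : forall eps, 0 < eps -> Rabs (d (b s) (b t) - Rabs (s - t)) <= 2 * eps).
      { intros eps He.
        destruct (Hb s Hs eps He) as [N1 HN1]. destruct (Hb t Ht eps He) as [N2 HN2].
        destruct (Hpair (s + t) ltac:(lra)) as [N3 HN3].
        set (n := (N1 + N2 + N3)%nat).
        assert (A1 := HN1 n ltac:(lia)). assert (A2 := HN2 n ltac:(lia)).
        destruct (HN3 n n ltac:(lia) ltac:(lia)) as [A3 _].
        assert (A4 := proj2 (Hg1 n) s t ltac:(lra) ltac:(lra)). rewrite <- A4.
        assert (B1 := dist_tri (b s) (g n s) (b t)). assert (B2 := dist_tri (g n s) (g n t) (b t)).
        assert (B3 := dist_tri (g n s) (b s) (g n t)). assert (B4 := dist_tri (b s) (b t) (g n t)).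
        rewrite (dist_sym (b s) (g n s)) in B1. rewrite (dist_sym (b t) (g n t)) in B4.
        apply Rabs_le. lra. }
      apply Rminus_diag_uniq. apply NNPP. intro Hne.
      assert (P := Rabs_pos_lt _ Hne). specialize (Happ _ (Rdiv_lt_0_compat _ 4 P ltac:(lra))).
      lra. }
  exists b. split; [exact Hray |].
  destruct (near_shift (image beta) m 1 Hm Rle_0_1) as [N1 [HN1 Hsh]].
  destruct (kappa_perturb kappa Hk (C0 + 1) ltac:(lra)) as [C1 [HC1 Hp1]].
  assert (HCC : 0 <= C * C1) by nra.
  exists (N1 + (C0 + C * C1 + 1)). split; [lra |]. split.
  - intros t Ht. apply near_weaken with N1; [lra |].
    destruct (Hb t Ht 1 Rlt_0_1) as [M1 HM1]. destruct (Hpair t Ht) as [M2 HM2].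
    set (n := (M1 + M2)%nat). assert (A1 := HM1 n ltac:(lia)).
    destruct (HM2 n n ltac:(lia) ltac:(lia)) as [A2 _].
    apply (Hsh (b t) (g n t)).
    + rewrite dist_sym. assert (K1 := kappa_norm_ge1 (b t)). lra.
    + apply (HMorse (g n) (len n)); auto; try lra.
      rewrite Hg3. exists (INR n). split; [apply pos_INR | reflexivity].
  - intros z [a [Ha <-]]. apply near_weaken with (C0 + C * C1 + 1); [lra |].
    set (k := kappa (d o (beta a))). assert (Hk1 : 1 <= k) by apply kappa_norm_ge1.
    assert (Hna := dist_ge0 o (beta a)).
    set (r := d o (beta a) + (C0 + 1) * k).
    (* The time [t] below depends on [n], so [n] cannot be chosen after it; the bound [r], fixed
       first, serves for every possible [t]. *)
    assert (Hr : 0 < r) by (unfold r; nra).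
    destruct (Hpair' r Hr) as [M1 HM1]. destruct (Hlarge a) as [M2 HM2].
    set (n := (M1 + M2)%nat).
    destruct (Hback (g n) (len n) a (INR n) (Hg1 n) (Hg2 n) (Hg3 n)) as [t [Ht Dt]].
    { split; [exact Ha |]. apply HM2. lia. }
    fold k in Dt.
    assert (Htr : t <= r).
    { assert (A := dist_tri o (beta a) (g n t)).
      rewrite <- (Hg2 n) in A at 1. rewrite (geodesic_from_start _ _ t (Hg1 n) Ht) in A.
      unfold r. lra. }
    destruct (Hb t (proj1 Ht) 1 Rlt_0_1) as [M3 HM3].
    set (n' := (n + M3)%nat).
    destruct (HM1 n n' ltac:(lia) ltac:(lia)) as [_ A1]. specialize (A1 t ltac:(lra)).
    assert (A2 := HM3 n' ltac:(lia)).
    assert (Kr : kappa r <= C1 * k) by exact (Hp1 _ r Hna (Rlt_le _ _ Hr) (Rle_refl _)).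
    assert (A3 : t / r * (C * kappa r) <= C * C1 * k).
    { assert (Htr1 : t / r <= 1).
      { apply Rmult_le_reg_r with r; [exact Hr |]. unfold Rdiv.
        rewrite Rmult_assoc, Rinv_l by lra. lra. }
      assert (K1 := kappa_ge1 kappa Hk r ltac:(lra)).
      assert (C * kappa r <= C * (C1 * k)) by (apply Rmult_le_compat_l; assumption).
      assert (0 <= C * kappa r) by nra. nra. }
    exists (b t). split; [exists t; split; [lra | reflexivity] |]. fold k.
    assert (T1 := dist_tri (beta a) (g n t) (b t)).
    assert (T2 := dist_tri (g n t) (g n' t) (b t)). nra.
Qed.

End Limit.

(** * The equivalences *)

Lemma fellow_travel_near g h :
  fellow_travel d o kappa g h <->
  exists n, 0 <= n /\ (forall x, image g x -> near (image h) n x) /\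
    (forall x, image h x -> near (image g) n x).
Proof.
  split.
  - intros [[n Hn] [n' Hn']]. exists (Rmax 0 (Rmax (n + 1) (n' + 1))).
    assert (A1 := Rmax_l 0 (Rmax (n + 1) (n' + 1))).
    assert (A2 := Rmax_r 0 (Rmax (n + 1) (n' + 1))).
    assert (A3 := Rmax_l (n + 1) (n' + 1)). assert (A4 := Rmax_r (n + 1) (n' + 1)).
    split; [exact A1 |]. split; intros x Hx.
    + apply near_weaken with (n + 1); [lra |]. apply Nbhd_near. auto.
    + apply near_weaken with (n' + 1); [lra |]. apply Nbhd_near. auto.
  - intros (n & _ & H1 & H2). split; exists n; intros x Hx; apply near_Nbhd; auto.
Qed.

Lemma fellow_travel_refl g : fellow_travel d o kappa g g.
Proof.
  apply fellow_travel_near. exists 0. split; [lra |].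
  assert (H : forall x, image g x -> near (image g) 0 x); [| auto].
  intros x Hx. exists x. split; [exact Hx |]. rewrite dist_refl. lra.
Qed.

Lemma fellow_travel_sym g h : fellow_travel d o kappa g h -> fellow_travel d o kappa h g.
Proof. intros [H1 H2]. split; assumption. Qed.

Lemma fellow_travel_trans f g h :
  fellow_travel d o kappa f g -> fellow_travel d o kappa g h -> fellow_travel d o kappa f h.
Proof.
  rewrite !fellow_travel_near. intros (n & Hn & A1 & A2) (n' & Hn' & B1 & B2).
  destruct (near_trans (image g) (image h) n n' Hn Hn' B1) as [N [HN HN1]].
  destruct (near_trans (image g) (image f) n' n Hn' Hn A2) as [N' [HN' HN2]].
  exists (N + N'). split; [lra |]. split; intros x Hx.
  - apply near_weaken with N; [lra | auto].
  - apply near_weaken with N'; [lra | auto].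
Qed.

Lemma qg_ray_origin g : qg_ray d o g -> image g o.
Proof. intros (q & Q & _ & _ & H0 & _). exists 0. split; [lra | exact H0]. Qed.

Lemma fellow_travel_contracting g h :
  qg_ray d o g -> qg_ray d o h -> fellow_travel d o kappa g h ->
  kappa_contracting d o kappa (image g) -> kappa_contracting d o kappa (image h).
Proof.
  intros Hg Hh H. apply fellow_travel_near in H. destruct H as (n & Hn & H1 & H2).
  apply (contracting_invariant (image g) (image h) n n); auto using qg_ray_origin, image_qg_ray_proximinal.
Qed.

Lemma qg_segment_hinge_32 z T : qg_segment d z 3 0 0 T -> qg_segment d z 32 0 0 T.
Proof.
  intros (HT & Hc & Hz). split; [exact HT |]. split; [exact Hc |]. intros s t Hs Ht.
  destruct (Hz s t Hs Ht). assert (P := Rabs_pos (s - t)). lra.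
Qed.

(** The ray itself serves as the set [Z], with [n = 0]; [Rmax] supplies a nonnegative constant, as
    [M] has no prescribed sign. *)
Lemma Morse_32_contracting b :
  geodesic_ray d o b -> Morse_32 d o kappa (image b) -> kappa_contracting d o kappa (image b).
Proof.
  intros Hb [M HM].
  apply (geodesic_ray_contracting b (image b) 0 (Rmax 0 (M + 1))); auto using Rmax_l, Rle_refl.
  - intros t Ht. exists (b t). split; [exists t; auto |]. rewrite dist_refl. lra.
  - intros z Hz. exists z. split; [exact Hz |]. rewrite dist_refl. lra.
  - intros z T Hz H0 H1 t Ht. apply near_weaken with (M + 1); [apply Rmax_r |].
    apply Nbhd_near. apply (HM z 0 T); auto using qg_segment_hinge_32.
Qed.

(** The Morse property for geodesics from [o] yields the limit ray, and the one for
    (3,0)-quasi-geodesics with ends on [beta] yields its contraction. *)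
Lemma Morse_ray_contracting_geodesic beta :
  qg_ray d o beta -> kappa_Morse d o kappa (image beta) ->
  exists b, geodesic_ray d o b /\ fellow_travel d o kappa beta b /\
    kappa_contracting d o kappa (image b).
Proof.
  intros (q & Q & Hq & HQ & H0 & _ & Hbeta) [m [Hm0 Hm]].
  assert (Hgeod : forall s L, geodesic_segment d s L -> s 0 = o -> image beta (s L) ->
            forall t, 0 <= t <= L -> near (image beta) (m 1 0 + 1) (s t)).
  { intros s L [HL Hs] s0 sL t Ht. apply Nbhd_near.
    apply (Hm 1 0 Rlt_0_1 (Rle_refl 0) s 0 L); try assumption.
    - split; [exact HL |]. split.
      + intros u Hu eps He. exists eps. split; [exact He |]. intros v Hv. rewrite Hs by assumption. auto.
      + intros u v Hu Hv. rewrite Hs by assumption. lra.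
    - rewrite s0. exists 0. split; [lra | exact H0]. }
  assert (Hm1 := Hm0 1 0). assert (Hm3 := Hm0 3 0).
  destruct (geodesic_limit_ray beta q Q (m 1 0 + 1)) as (b & Hb & N & HN & N1 & N2);
    try assumption; try lra.
  exists b. split; [exact Hb |]. split.
  - apply fellow_travel_near. exists N. split; [exact HN |]. split; [exact N2 |].
    intros x [t [Ht <-]]. auto.
  - apply (geodesic_ray_contracting b (image beta) N (m 3 0 + 1)); auto; try lra.
    intros z T Hz Hz0 HzT t Ht. apply Nbhd_near.
    apply (Hm 3 0 ltac:(lra) ltac:(lra) z 0 T); assumption.
Qed.

End Space.

Theorem theorem3p5 (X : Type) (d : X -> X -> R) (o : X) (kappa : R -> R)
  (HX : CAT0_space d) (Hprop : proper_space d) (Hk : kappa_ok kappa)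
  (b0 : R -> X) (Hb0 : qg_ray d o b0) :
  let inb := fun g : R -> X => qg_ray d o g /\ fellow_travel d o kappa b0 g in
  let P1 := exists g, inb g /\ geodesic_ray d o g /\ kappa_contracting d o kappa (image g) in
  let P2 := forall g, inb g -> kappa_contracting d o kappa (image g) in
  let P3 := forall g, inb g -> kappa_Morse d o kappa (image g) in
  let P4 := exists g, inb g /\ kappa_Morse d o kappa (image g) in
  let P5 := exists g, inb g /\ geodesic_ray d o g /\ Morse_32 d o kappa (image g) in
  (P1 <-> P2) /\ (P1 <-> P3) /\ (P1 <-> P4) /\ (P1 <-> P5).
Proof.
  intros inb P1 P2 P3 P4 P5. destruct HX as (Hmet & Hgeo & Hcat).
  assert (H12 : P1 -> P2).
  { intros (g & [Hg Hfg] & _ & Hc) h [Hh Hfh].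
    apply (fellow_travel_contracting X d o kappa Hmet Hk Hgeo g h Hg Hh); [| exact Hc].
    apply (fellow_travel_trans X d o kappa Hmet Hk g b0 h); [| exact Hfh].
    apply fellow_travel_sym. exact Hfg. }
  assert (H23 : P2 -> P3).
  { intros H g Hg. apply contracting_Morse; auto.
    apply (image_qg_ray_proximinal X d o Hmet). apply Hg. }
  assert (H34 : P3 -> P4).
  { intro H. assert (Hin : inb b0) by (split; [exact Hb0 | apply fellow_travel_refl; assumption]).
    exists b0. auto. }
  assert (H41 : P4 -> P1).
  { intros (g & [Hg Hfg] & Hm).
    destruct (Morse_ray_contracting_geodesic X d o kappa Hmet Hk Hgeo Hcat Hprop g Hg Hm)
      as (b & Hb & Hfb & Hc).
    exists b. split; [split |].
    - apply geodesic_ray_qg_ray; assumption.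
    - apply (fellow_travel_trans X d o kappa Hmet Hk b0 g b); assumption.
    - split; assumption. }
  assert (H15 : P1 -> P5).
  { intro H. assert (H3 := H23 (H12 H)). destruct H as (g & Hg & Hgg & _).
    exists g. split; [exact Hg |]. split; [exact Hgg |].
    destruct (H3 g Hg) as [m [_ Hm]]. exists (m 32 0).
    intros z a c. apply Hm; lra. }
  assert (H51 : P5 -> P1).
  { intros (g & Hg & Hgg & Hm). exists g. split; [exact Hg |]. split; [exact Hgg |].
    apply (Morse_32_contracting X d o kappa Hmet Hk Hgeo Hcat); assumption. }
  tauto.
Qed.
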